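(* Let $G$ and $H$ be countable (discrete) groups with the Haagerup property. Then the restricted second nilpotent wreath product $P\rtimes G$ of $H$ and $G$ has the Haagerup property, where $P$ is the second nilpotent product of copies of $H$ indexed by $G$ and $G$ acts on $P$ by shifting the indices.
   Context: Commutators are $[a,b]=aba^{-1}b^{-1}$. For a family of groups $\{H_i\}_{i\in\mathcal I}$ with free product $F=\ast_{i\in\mathcal I}H_i$, the second nilpotent product of the family is the quotient $F/N$, where $N$ is the normal subgroup of $F$ generated by all elements $[x,[h_j,h_k]]$ with $x\in F$, $h_j\in H_j$, $h_k\in H_k$, $j\neq k$ in $\mathcal I$. For groups $H$ and $G$, let $P$ be the second nilpotent product of the family $\{H_g\}_{g\in G}$ with $H_g=H$ for all $g\in G$. The shift action of $G$ on the free product $\ast_{g\in G}H_g$ (the element $g\in G$ maps the copy $H_k$ identically onto the copy $H_{gk}$) preserves $N$ and hence induces an action of $G$ on $P$ by automorphisms. The semidirect product $P\rtimes G$ for this action is called the restricted second nilpotent wreath product of $H$ and $G$. *)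

(* Defs.v *)
From HB Require Import structures.
From mathcomp Require Import all_boot all_order all_algebra.
From mathcomp Require Import complex.
From mathcomp Require Import all_classical all_reals all_analysis.

Set Implicit Arguments.
Unset Strict Implicit.
Unset Printing Implicit Defensive.

Import Order.TTheory GRing.Theory Num.Theory.
Import numFieldNormedType.Exports.

Local Open Scope quotient_scope.
Local Open Scope classical_set_scope.
Local Open Scope group_scope.

(** * Normal subgroups and quotients of arbitrary groups *)

(* [[~ x, y]] of the library is x^-1 y^-1 x y; here the convention is
   [x, y] = x y x^-1 y^-1. *)
Definition comm (F : groupType) (x y : F) : F := x * y * x^-1 * y^-1.

Record normalSubgroup (F : groupType) := NormalSubgroup {
  nsg_set :> F -> Prop;
  nsg1 : nsg_set 1;
  nsgM : forall x y, nsg_set x -> nsg_set y -> nsg_set (x * y);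
  nsgV : forall x, nsg_set x -> nsg_set x^-1;
  nsgJ : forall x y, nsg_set x -> nsg_set (y * x * y^-1) }.

Section NormalClosure.
Variables (F : groupType) (S : set F).

Definition normal_closure_set : set F :=
  [set x | forall N : normalSubgroup F, S `<=` nsg_set N -> N x].

Fact normal_closure1 : normal_closure_set 1.
Proof. by move=> N _; exact: nsg1. Qed.

Fact normal_closureM x y :
  normal_closure_set x -> normal_closure_set y -> normal_closure_set (x * y).
Proof. by move=> Sx Sy N SN; apply: nsgM; [exact: Sx|exact: Sy]. Qed.

Fact normal_closureV x : normal_closure_set x -> normal_closure_set x^-1.
Proof. by move=> Sx N SN; apply: nsgV; exact: Sx. Qed.

Fact normal_closureJ x y :
  normal_closure_set x -> normal_closure_set (y * x * y^-1).
Proof. by move=> Sx N SN; apply: nsgJ; exact: Sx. Qed.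

Definition normal_closure : normalSubgroup F :=
  NormalSubgroup normal_closure1 normal_closureM normal_closureV
    normal_closureJ.

End NormalClosure.

Section Quotient.
Variables (F : groupType) (N : normalSubgroup F).

Definition nsg_rel (x y : F) : bool := `[< N (x^-1 * y) >].

Fact nsg_rel_refl : reflexive nsg_rel.
Proof. by move=> x; apply/asboolP; rewrite mulVg; exact: nsg1. Qed.

Fact nsg_rel_sym : symmetric nsg_rel.
Proof.
suff impl x y : nsg_rel x y -> nsg_rel y x by move=> x y; apply/idP/idP => /impl.
by move=> /asboolP/nsgV; rewrite invgM invgK => ?; exact/asboolP.
Qed.

Fact nsg_rel_trans : transitive nsg_rel.
Proof.
move=> y x z /asboolP Nxy /asboolP Nyz; apply/asboolP.
by have := nsgM Nxy Nyz; rewrite -mulgA mulVKg.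
Qed.

Canonical nsg_equiv := EquivRel nsg_rel nsg_rel_refl nsg_rel_sym nsg_rel_trans.

Definition quot_group := {eq_quot nsg_equiv}.
HB.instance Definition _ := Choice.on quot_group.
HB.instance Definition _ := Quotient.on quot_group.
HB.instance Definition _ : EqQuotient F nsg_rel quot_group :=
  EqQuotient.on quot_group.

Definition quot_pi (x : F) : quot_group := \pi_quot_group x.

Definition quot_one : quot_group := quot_pi 1.
Definition quot_mul (a b : quot_group) : quot_group :=
  quot_pi (repr a * repr b).
Definition quot_inv (a : quot_group) : quot_group := quot_pi (repr a)^-1.

Fact quot_reprK (a : quot_group) : quot_pi (repr a) = a.
Proof. exact: reprK. Qed.

Fact quot_piW (P : quot_group -> Prop) :
  (forall x, P (quot_pi x)) -> forall a, P a.
Proof. by move=> Ppi a; rewrite -(quot_reprK a). Qed.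

Fact quot_relP (x y : F) :
  quot_pi x = quot_pi y <-> N (x^-1 * y).
Proof. by split => [/eqquotP/asboolP //|Nxy]; apply/eqquotP/asboolP. Qed.

Fact quot_mulE x y :
  quot_mul (quot_pi x) (quot_pi y) = quot_pi (x * y).
Proof.
apply/quot_relP; rewrite invgM.
set x' := repr (quot_pi x); set y' := repr (quot_pi y).
have /quot_relP Nx : quot_pi x' = quot_pi x by rewrite quot_reprK.
have /quot_relP Ny : quot_pi y' = quot_pi y by rewrite quot_reprK.
rewrite -mulgA (mulgA x'^-1).
have := nsgM (nsgJ y'^-1 Nx) Ny.
by rewrite invgK -!mulgA mulVKg.
Qed.

Fact quot_invE x : quot_inv (quot_pi x) = quot_pi x^-1.
Proof.
apply/quot_relP; rewrite invgK; set x' := repr _.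
have /quot_relP : quot_pi x = quot_pi x' by rewrite quot_reprK.
by move=> /(nsgJ x); rewrite !mulgA mulgV mul1g.
Qed.

Fact quot_mulA : associative quot_mul.
Proof.
by elim/quot_piW => x; elim/quot_piW => y; elim/quot_piW => z; rewrite !quot_mulE mulgA.
Qed.

Fact quot_mul1g : left_id quot_one quot_mul.
Proof. by elim/quot_piW => x; rewrite quot_mulE mul1g. Qed.

Fact quot_mulg1 : right_id quot_one quot_mul.
Proof. by elim/quot_piW => x; rewrite quot_mulE mulg1. Qed.

Fact quot_mulVg : left_inverse quot_one quot_inv quot_mul.
Proof. by elim/quot_piW => x; rewrite quot_invE quot_mulE mulVg. Qed.

Fact quot_mulgV : right_inverse quot_one quot_inv quot_mul.
Proof. by elim/quot_piW => x; rewrite quot_invE quot_mulE mulgV. Qed.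

HB.instance Definition _ := isGroup.Build quot_group
  quot_mulA quot_mul1g quot_mulg1 quot_mulVg quot_mulgV.

End Quotient.

(** * Free products *)

(* The free product of the [H i] is the set of words in the disjoint union of
   the [H i], under concatenation, modulo the congruence generated by
   (i, 1) ~ empty word and (i, a)(i, b) ~ (i, ab). *)
Section FreeProduct.
Variables (I : choiceType) (H : I -> groupType).

Definition fp_word := seq {i : I & H i}.
HB.instance Definition _ := Choice.on fp_word.

Definition fp_letter (i : I) (a : H i) : {i : I & H i} :=
  Tagged (fun i => H i : Type) a.

Inductive fp_eqv : fp_word -> fp_word -> Prop :=
| FpRefl w : fp_eqv w w
| FpSym v w : fp_eqv v w -> fp_eqv w v
| FpTrans u v w : fp_eqv u v -> fp_eqv v w -> fp_eqv u w
| FpOne u v i : fp_eqv (u ++ fp_letter (1 : H i) :: v) (u ++ v)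
| FpMul u v i (a b : H i) :
    fp_eqv (u ++ [:: fp_letter a, fp_letter b & v])
           (u ++ fp_letter (a * b) :: v).

Definition fp_rel (v w : fp_word) : bool := `[< fp_eqv v w >].

Fact fp_rel_refl : reflexive fp_rel.
Proof. by move=> w; apply/asboolP; exact: FpRefl. Qed.

Fact fp_rel_sym : symmetric fp_rel.
Proof. by move=> v w; apply/asboolP/asboolP; exact: FpSym. Qed.

Fact fp_rel_trans : transitive fp_rel.
Proof.
by move=> v u w /asboolP uv /asboolP vw; apply/asboolP; exact: FpTrans vw.
Qed.

Canonical fp_equiv := EquivRel fp_rel fp_rel_refl fp_rel_sym fp_rel_trans.

Definition free_product := {eq_quot fp_equiv}.
HB.instance Definition _ := Choice.on free_product.
HB.instance Definition _ := Quotient.on free_product.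
HB.instance Definition _ : EqQuotient fp_word fp_rel free_product :=
  EqQuotient.on free_product.

Definition fp_class (w : fp_word) : free_product := \pi w.

Fact fp_classP v w : fp_class v = fp_class w <-> fp_eqv v w.
Proof. by split => [/eqquotP/asboolP //|vw]; apply/eqquotP/asboolP. Qed.

Fact fp_eqv_cat2l u v w : fp_eqv v w -> fp_eqv (u ++ v) (u ++ w).
Proof.
elim=> {v w} [w|v w _ vw|w1 w2 w3 _ w12 _ w23|v w i|v w i a b].
- exact: FpRefl.
- exact: FpSym.
- exact: FpTrans w23.
- by rewrite !catA; exact: FpOne.
- by rewrite !catA; exact: FpMul.
Qed.

Fact fp_eqv_cat2r u v w : fp_eqv v w -> fp_eqv (v ++ u) (w ++ u).
Proof.
elim=> {v w} [w|v w _ vw|w1 w2 w3 _ w12 _ w23|v w i|v w i a b].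
- exact: FpRefl.
- exact: FpSym.
- exact: FpTrans w23.
- by rewrite -!catA; exact: FpOne.
- by rewrite -!catA; exact: FpMul.
Qed.

Definition fp_word_inv (w : fp_word) : fp_word :=
  rev [seq (let: existT i a := l in fp_letter (a : H i)^-1) | l <- w].

Fact fp_eqv_inv v w : fp_eqv v w -> fp_eqv (fp_word_inv v) (fp_word_inv w).
Proof.
rewrite /fp_word_inv.
elim=> {v w} [w|v w _ vw|w1 w2 w3 _ w12 _ w23|v w i|v w i a b].
- exact: FpRefl.
- exact: FpSym.
- exact: FpTrans w23.
- by rewrite !map_cat !rev_cat /= rev_cons cat_rcons invg1; exact: FpOne.
- rewrite !map_cat !rev_cat /= !rev_cons !cat_rcons invgM; exact: FpMul.
Qed.

Fact fp_eqv_mulVw w : fp_eqv (fp_word_inv w ++ w) [::].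
Proof.
rewrite /fp_word_inv; elim: w => [|[i a] w IHw]; first exact: FpRefl.
rewrite /= rev_cons cat_rcons.
apply: FpTrans IHw; apply: FpTrans (FpMul _ _ _ _) _.
by rewrite mulVg; exact: FpOne.
Qed.

Fact fp_eqv_mulwV w : fp_eqv (w ++ fp_word_inv w) [::].
Proof.
have wK : fp_word_inv (fp_word_inv w) = w.
  rewrite /fp_word_inv map_rev revK -map_comp.
  by apply: map_id_in => -[i a] _ /=; rewrite invgK.
by have := fp_eqv_mulVw (fp_word_inv w); rewrite wK.
Qed.

Definition fp_one : free_product := fp_class [::].
Definition fp_mul (x y : free_product) : free_product :=
  fp_class (repr x ++ repr y).
Definition fp_inv (x : free_product) : free_product :=
  fp_class (fp_word_inv (repr x)).

Fact fp_repr_class w : fp_eqv (repr (fp_class w)) w.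
Proof. by apply/fp_classP; rewrite /fp_class reprK. Qed.

Fact fp_mulE v w : fp_mul (fp_class v) (fp_class w) = fp_class (v ++ w).
Proof.
apply/fp_classP; apply: (FpTrans (v := v ++ repr (fp_class w))).
- exact/fp_eqv_cat2r/fp_repr_class.
- exact/fp_eqv_cat2l/fp_repr_class.
Qed.

Fact fp_invE w : fp_inv (fp_class w) = fp_class (fp_word_inv w).
Proof. exact/fp_classP/fp_eqv_inv/fp_repr_class. Qed.

Fact fp_classW (P : free_product -> Prop) :
  (forall w, P (fp_class w)) -> forall x, P x.
Proof. by move=> Pw; elim/quotW. Qed.

Fact fp_mulA : associative fp_mul.
Proof.
by elim/fp_classW => u; elim/fp_classW => v; elim/fp_classW => w;
  rewrite !fp_mulE catA.
Qed.

Fact fp_mul1g : left_id fp_one fp_mul.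
Proof. by elim/fp_classW => w; rewrite fp_mulE. Qed.

Fact fp_mulg1 : right_id fp_one fp_mul.
Proof. by elim/fp_classW => w; rewrite fp_mulE cats0. Qed.

Fact fp_mulVg : left_inverse fp_one fp_inv fp_mul.
Proof.
by elim/fp_classW => w; rewrite fp_invE fp_mulE; exact/fp_classP/fp_eqv_mulVw.
Qed.

Fact fp_mulgV : right_inverse fp_one fp_inv fp_mul.
Proof.
by elim/fp_classW => w; rewrite fp_invE fp_mulE; exact/fp_classP/fp_eqv_mulwV.
Qed.

HB.instance Definition _ := isGroup.Build free_product
  fp_mulA fp_mul1g fp_mulg1 fp_mulVg fp_mulgV.

Definition fp_in (i : I) (a : H i) : free_product := fp_class [:: fp_letter a].

Fact fp_inM i (a b : H i) : fp_in (a * b) = fp_in a * fp_in b.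
Proof.
rewrite /fp_in; apply/esym; rewrite [LHS]fp_mulE.
exact/fp_classP/(FpMul [::] [::]).
Qed.

End FreeProduct.

(** * The second nilpotent product *)

Section SecondNilpotentProduct.
Variables (I : choiceType) (H : I -> groupType).

Definition nil2_relators : set (free_product H) :=
  [set z | exists (x : free_product H) (j k : I) (a : H j) (b : H k),
     j != k /\ z = comm x (comm (fp_in a) (fp_in b))].

Definition nil2_kernel : normalSubgroup (free_product H) :=
  normal_closure nil2_relators.

Definition nil2_product := quot_group nil2_kernel.
HB.instance Definition _ := Group.on nil2_product.

End SecondNilpotentProduct.

(** * Semidirect products *)

(* Left actions of [G] on [P] by group automorphisms. *)
Record autAction (G P : groupType) := AutAction {
  aut_act :> G -> P -> P;
  aut_act1 : forall x, aut_act 1 x = x;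
  aut_actA : forall g h x, aut_act (g * h) x = aut_act g (aut_act h x);
  aut_actM : forall g x y, aut_act g (x * y) = aut_act g x * aut_act g y }.

(* A record, since [P * G] already carries the direct product structure. *)
Record semidirect (G P : groupType) (to : autAction G P) :=
  Semidirect { sd_fst : P; sd_snd : G }.

Section SemidirectProduct.
Variables (G P : groupType) (to : autAction G P).

Local Notation semidirect := (semidirect to).
Local Notation Semidirect := (Semidirect to).

Fact semidirectK :
  cancel (fun u : semidirect => (sd_fst u, sd_snd u))
         (fun p => Semidirect p.1 p.2).
Proof. by case. Qed.

HB.instance Definition _ := Equality.copy semidirect (can_type semidirectK).
HB.instance Definition _ := Choice.copy semidirect (can_type semidirectK).

Definition sd_one : semidirect := Semidirect 1 1.
Definition sd_mul (u v : semidirect) : semidirect :=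
  Semidirect (sd_fst u * to (sd_snd u) (sd_fst v)) (sd_snd u * sd_snd v).
Definition sd_inv (u : semidirect) : semidirect :=
  Semidirect (to (sd_snd u)^-1 (sd_fst u)^-1) (sd_snd u)^-1.

Fact aut_act_1 g : to g 1 = 1.
Proof. by apply: (mulgI (to g 1)); rewrite -aut_actM !mulg1. Qed.

Fact sd_mulA : associative sd_mul.
Proof.
by move=> [p g] [q h] [r k]; rewrite /sd_mul /= aut_actM aut_actA !mulgA.
Qed.

Fact sd_mul1g : left_id sd_one sd_mul.
Proof. by move=> [p g]; rewrite /sd_mul /= aut_act1 !mul1g. Qed.

Fact sd_mulg1 : right_id sd_one sd_mul.
Proof. by move=> [p g]; rewrite /sd_mul /= aut_act_1 !mulg1. Qed.

Fact sd_mulVg : left_inverse sd_one sd_inv sd_mul.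
Proof.
by move=> [p g]; rewrite /sd_mul /= -aut_actM !mulVg aut_act_1.
Qed.

Fact sd_mulgV : right_inverse sd_one sd_inv sd_mul.
Proof.
by move=> [p g]; rewrite /sd_mul /= -aut_actA mulgV aut_act1 mulgV.
Qed.

HB.instance Definition _ := isGroup.Build semidirect
  sd_mulA sd_mul1g sd_mulg1 sd_mulVg sd_mulgV.

End SemidirectProduct.

(** * The restricted second nilpotent wreath product *)

Section NilpotentWreath.
Variables (H G : groupType).

Local Notation Hs := (fun _ : G => H).
Local Notation F := (free_product Hs).

Definition shift_letter (g : G) (l : {k : G & Hs k}) : {k : G & Hs k} :=
  @fp_letter G Hs (g * tag l) (tagged l).

Definition shift_word (g : G) (w : fp_word Hs) : fp_word Hs :=
  [seq shift_letter g l | l <- w].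

Definition fp_shift (g : G) (x : F) : F := fp_class (shift_word g (repr x)).

Fact shift_word_eqv g v w :
  fp_eqv v w -> fp_eqv (shift_word g v) (shift_word g w).
Proof.
rewrite /shift_word.
elim=> {v w} [w|v w _ vw|w1 w2 w3 _ w12 _ w23|v w i|v w i a b].
- exact: FpRefl.
- exact: FpSym.
- exact: FpTrans w23.
- by rewrite !map_cat /=; exact: (@FpOne G Hs).
- by rewrite !map_cat /=; exact: (@FpMul G Hs).
Qed.

Fact fp_shiftE g (w : fp_word Hs) :
  fp_shift g (fp_class w) = fp_class (shift_word g w).
Proof. exact/fp_classP/shift_word_eqv/fp_repr_class. Qed.

Fact fp_shift_in g k (a : H) :
  fp_shift g (@fp_in G Hs k a) = @fp_in G Hs (g * k) a.
Proof. by rewrite /fp_in fp_shiftE. Qed.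

Fact fp_shift1 x : fp_shift 1 x = x.
Proof.
elim/fp_classW: x => w; rewrite fp_shiftE; congr fp_class.
by apply: map_id_in => -[k a] _; rewrite /shift_letter /= mul1g.
Qed.

Fact fp_shiftA g h x : fp_shift (g * h) x = fp_shift g (fp_shift h x).
Proof.
elim/fp_classW: x => w; rewrite !fp_shiftE; congr fp_class.
rewrite /shift_word -map_comp; apply: eq_map => -[k a].
by rewrite /shift_letter /= mulgA.
Qed.

Fact fp_shiftM g x y : fp_shift g (x * y) = fp_shift g x * fp_shift g y.
Proof.
elim/fp_classW: x => v; elim/fp_classW: y => w.
rewrite [fp_class v * _]fp_mulE !fp_shiftE [RHS]fp_mulE.
by rewrite /shift_word map_cat.
Qed.

Fact fp_shift_1 g : fp_shift g 1 = 1.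
Proof. by apply: (mulgI (fp_shift g 1)); rewrite -fp_shiftM !mulg1. Qed.

Fact fp_shiftV g x : fp_shift g x^-1 = (fp_shift g x)^-1.
Proof.
by apply: (mulgI (fp_shift g x)); rewrite -fp_shiftM !mulgV fp_shift_1.
Qed.

Fact fp_shift_kernel g x :
  nil2_kernel Hs x -> nil2_kernel Hs (fp_shift g x).
Proof.
move=> Nx M relM.
pose M' : set F := [set y | M (fp_shift g y)].
have M'1 : M' 1 by rewrite /M' /= fp_shift_1; exact: nsg1.
have M'M y z : M' y -> M' z -> M' (y * z).
  by rewrite /M' /= fp_shiftM; exact: nsgM.
have M'V y : M' y -> M' y^-1 by rewrite /M' /= fp_shiftV; exact: nsgV.
have M'J y z : M' y -> M' (z * y * z^-1).
  by rewrite /M' /= !fp_shiftM fp_shiftV; exact: nsgJ.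
apply: (Nx (NormalSubgroup M'1 M'M M'V M'J)) => _ [y [j [k [a [b [jk ->]]]]]].
rewrite /= /M' /=; apply: relM.
exists (fp_shift g y), (g * j), (g * k), a, b; split.
  by apply: contra jk => /eqP/mulgI ->.
by rewrite /comm !(fp_shiftM, fp_shiftV) !fp_shift_in.
Qed.

Definition nil2_shift (g : G) (p : nil2_product Hs) : nil2_product Hs :=
  quot_pi (nil2_kernel Hs) (fp_shift g (repr p)).

Fact nil2_shiftE g x :
  nil2_shift g (quot_pi (nil2_kernel Hs) x) =
  quot_pi (nil2_kernel Hs) (fp_shift g x).
Proof.
apply/quot_relP; rewrite -fp_shiftV -fp_shiftM; apply: fp_shift_kernel.
by apply/quot_relP; rewrite quot_reprK.
Qed.

Fact nil2_shift1 p : nil2_shift 1 p = p.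
Proof. by elim/quot_piW: p => x; rewrite nil2_shiftE fp_shift1. Qed.

Fact nil2_shiftA g h p : nil2_shift (g * h) p = nil2_shift g (nil2_shift h p).
Proof. by elim/quot_piW: p => x; rewrite !nil2_shiftE fp_shiftA. Qed.

Fact nil2_shiftM g p q :
  nil2_shift g (p * q) = nil2_shift g p * nil2_shift g q.
Proof.
elim/quot_piW: p => x; elim/quot_piW: q => y.
rewrite [quot_pi _ x * _]quot_mulE !nil2_shiftE [RHS]quot_mulE.
by rewrite fp_shiftM.
Qed.

Definition nil2_shift_action : autAction G (nil2_product Hs) :=
  AutAction nil2_shift1 nil2_shiftA nil2_shiftM.

Definition nil2_wreath : groupType := semidirect nil2_shift_action.

End NilpotentWreath.

(** * The Haagerup property *)

Section Haagerup.
Variables (R : realType) (G : groupType).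
Local Open Scope ring_scope.

(* In [R[i]], [0 <= z] means that z is a nonnegative real number. *)
Definition positive_definite (phi : G -> R[i]) : Prop :=
  forall (n : nat) (g : 'I_n -> G) (c : 'I_n -> R[i]),
    0 <= \sum_(i < n) \sum_(j < n) c i * (c j)^* * phi ((g j)^-1 * g i)%g.

Definition vanishes_at_infinity (phi : G -> R[i]) : Prop :=
  forall e : R, 0 < e -> finite_set [set g | e%:C%C <= `|phi g|].

(* The usual form for countable discrete groups: pointwise convergence along a
   sequence. *)
Definition haagerup : Prop :=
  exists phi : nat -> G -> R[i],
    [/\ forall n, positive_definite (phi n) /\ phi n 1%g = 1,
        forall n, vanishes_at_infinity (phi n)
      & forall g, (phi n g : R[i]^o) @[n --> \oo] --> (1 : R[i]^o)].

End Haagerup.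

(* Main.v *)
Require Import Defs.
From mathcomp Require Import all_boot all_order all_algebra.
From mathcomp Require Import complex.
From mathcomp Require Import all_classical all_reals all_analysis.
From mathcomp Require Import ring lra.

Set Implicit Arguments.
Unset Strict Implicit.
Unset Printing Implicit Defensive.

Import Order.TTheory GRing.Theory Num.Theory.
Import numFieldNormedType.Exports.

Local Open Scope classical_set_scope.
Local Open Scope ring_scope.

(** Let [W] be the wreath product, with elements [(p, x)], [p] in the second
nilpotent product [P] and [x] in [G].  All the work is done with real, symmetric,
normalized positive definite functions ([npd]).  By [haagerup_criterion] it is
enough to find, for every finite subset [Q] of [W] and every [e > 0], such a
function [f] with [f >= 1 - e] on [Q] and [`|f| > 3 / 4] only finitely often:
an infinite product of squares of such functions vanishes at infinity.
The function is (in [wreath_near_far])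
   f (p, x) = phi x * fwave (p, x) * alpha p
where [phi] is a function of this kind on [G] that vanishes at infinity.

The factor [fwave] confines the support of [p], the finite set of indices whose
copy of [H] occurs in [p].  Suppose that a random family of phases [U_y]
indexed by [y] in [G] has a [G]-invariant law with
   E (prod_y U_y ^ n_y) = exp (- sum_(y, z) n_y n_z phi (z^-1 y))
if the exponents [n_y] sum to [0], and [0] otherwise: [U_y] is close to [U_z]
if [phi (z^-1 y)] is close to [1], and not otherwise.  Put
[T_y = |(1 + U_y) / 2| ^ 2], a number in the unit interval, and let [u_x] be the normalized sum of the
[U_x ^ j], [j <= m], which concentrates where [U_x] is near [1].  Then
   fwave (p, x) = E (u_x * conj u_1 * prod_(y in supp p) T_y)
is near [1] on given elements if [m] is large and [phi] is near [1] on the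
indices involved, while a support point far from both [1] and [x] forces it
down to [3 / 4].  It is positive definite because every factor [T_y], with its
complement [1 - T_y = |(1 - U_y) / 2| ^ 2], is a Hermitian square, and because
[y \notin supp (q^-1 p)] is an equivalence relation on [p] and [q]
([sepP], [psd_damps_sep]).  No probability space is needed: the expectations of
monomials form the kernel [phase] on words in [G], and multiplication by [T_y] is
the operation [damp y] on kernels.  These phases play the part of the random
subsets of [G] (measured walls) in the proof of Cornulier, Stalder and Valette
for the ordinary wreath product.

Once [supp p] lies in a fixed finite set [E], it remains to control [p] in the
subgroup of [P] generated by the copies over [E], by a function [theta], and to
make this shift invariant: [alpha p] is the product over all [g] in [G] of the
values of [theta] at the [E]-parts of the translates [g^-1 p], all but finitely
many of which are trivial.  As for [theta], the products of elements of the
derived subgroups of the copies of [H] form a normal subgroup [derp] of [P]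
which meets trivially the common kernel of the coordinate maps
[component y : P -> H] ([derp_component]); so [p] is determined by its coordinates and its class
modulo [derp].  On the coordinates the Haagerup property of [H] applies.  The
quotient [P / derp] has central commutators ([nilquot_class2]), hence its finitely
generated subgroups have polynomial growth ([class2_growth]), and the balls of
slow growth are Folner sets which give finitely supported positive definite functions close to [1]
([class2_haagerup]). *)

(** * Positive semidefinite kernels *)

Section Kernels.
Variable R : realType.

(** Quadratic forms are indexed by lists of weighted points, possibly with
repetitions, so that substituting linear combinations for points is a flattening
of lists. *)
Definition qform (X : Type) (K : X -> X -> R) (s t : seq (R * X)) : R :=
  \sum_(a <- s) \sum_(b <- t) a.1 * b.1 * K a.2 b.2.

Definition psd (X : Type) (K : X -> X -> R) : Prop :=
  (forall x y, K x y = K y x) /\ (forall s, 0 <= qform K s s).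

Lemma eq_psd (X : Type) (K L : X -> X -> R) :
  (forall x y, K x y = L x y) -> psd L -> psd K.
Proof. by move=> KL; have -> : K = L by apply/funext => x; apply/funext. Qed.

(** If [K] is the Gram kernel of vectors [e_x], this is the Gram kernel of the
linear combinations [\sum_(a <- L z) a.1 e_(a.2)]. *)
Lemma psd_comb (X Z : Type) (L : Z -> seq (R * X)) (K : X -> X -> R) :
  psd K -> psd (fun z z' => qform K (L z) (L z')).
Proof.
move=> [Ksym Kpos]; split=> [z z'|s].
  rewrite /qform exchange_big /=; apply: eq_bigr => a _; apply: eq_bigr => b _.
  by rewrite Ksym (mulrC b.1).
pose s' := flatten [seq [seq (c.1 * a.1, a.2) | a <- L c.2] | c <- s].
have -> : qform (fun z z' => qform K (L z) (L z')) s s = qform K s' s'.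
  rewrite /qform /s' big_flatten big_map; apply: eq_bigr => c _.
  rewrite big_map.
  under [RHS]eq_bigr => a _ do rewrite big_flatten big_map.
  rewrite exchange_big /=; apply: eq_bigr => d _.
  rewrite mulr_sumr; apply: eq_bigr => a _; rewrite big_map mulr_sumr.
  by apply: eq_bigr => b _ /=; ring.
exact: Kpos.
Qed.

Lemma psd_pull (X Z : Type) (h : Z -> X) (K : X -> X -> R) :
  psd K -> psd (fun z z' => K (h z) (h z')).
Proof.
move=> /(psd_comb (fun z => [:: (1, h z)])); apply: eq_psd => z z'.
by rewrite /qform !big_seq1 /= !mul1r.
Qed.

Lemma psd_const (X : Type) (c : R) : 0 <= c -> psd (fun _ _ : X => c).
Proof.
move=> vanishing; split=> // s; rewrite /qform.
have -> : \sum_(a <- s) \sum_(b <- s) a.1 * b.1 * c = c * (\sum_(a <- s) a.1) ^+ 2.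
  rewrite expr2 mulr_suml mulr_sumr; apply: eq_bigr => a _.
  by rewrite mulr_sumr mulr_sumr; apply: eq_bigr => b _; ring.
by rewrite mulr_ge0 ?sqr_ge0.
Qed.

Lemma psdD (X : Type) (K L : X -> X -> R) :
  psd K -> psd L -> psd (fun x y => K x y + L x y).
Proof.
move=> [Ks Kp] [Ls Lp]; split=> [x y|s]; first by rewrite Ks Ls.
have -> : qform (fun x y => K x y + L x y) s s = qform K s s + qform L s s.
  rewrite /qform -big_split; apply: eq_bigr => a _ /=.
  by rewrite -big_split; apply: eq_bigr => b _ /=; rewrite mulrDr.
by rewrite addr_ge0.
Qed.

Lemma qform2 (X : Type) (K : X -> X -> R) (a b : R) (x y : X) :
  psd K -> 0 <= a ^+ 2 * K x x + 2 * (a * b) * K x y + b ^+ 2 * K y y.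
Proof.
move=> [Ks Kp]; have := Kp [:: (a, x); (b, y)].
rewrite /qform !big_cons !big_nil /= (Ks y x).
by congr (0 <= _); ring.
Qed.

Lemma psd_diag_ge0 (X : Type) (K : X -> X -> R) x : psd K -> 0 <= K x x.
Proof. by move=> /(qform2 1 0 x x); congr (0 <= _); ring. Qed.

(** The value at the weights [1] and [-1] (or [1] and [1]) on [x] and [y]. *)
Lemma psd_norm_le (X : Type) (K : X -> X -> R) x y :
  psd K -> 2 * `|K x y| <= K x x + K y y.
Proof.
move=> pK; have := qform2 1 1 x y pK; have := qform2 1 (-1) x y pK.
by case: (ger0P (K x y)) => _; lra.
Qed.

(** A vector of length zero: otherwise the form would be negative at the weights
[- (K y y + 1) / K x y] and [1]. *)
Lemma psd_diag0 (X : Type) (K : X -> X -> R) x y :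
  psd K -> K x x = 0 -> K x y = 0.
Proof.
move=> pK Kxx; have dy := psd_diag_ge0 y pK.
case: (eqVneq (K x y) 0) => // nz.
have := qform2 (- (K y y + 1) / K x y) 1 x y pK.
rewrite Kxx mulr0 add0r expr1n mul1r mulr1.
have -> : 2 * (- (K y y + 1) / K x y) * K x y = - 2 * (K y y + 1) by field.
lra.
Qed.

(** Subtract the projection on the line of [x0], that is, take a Schur
complement. *)
Lemma psd_peel1 (X : Type) (K : X -> X -> R) (x0 : X) : psd K ->
  exists v : X -> R, psd (fun x y => K x y - v x * v y) /\ K x0 x0 = v x0 * v x0.
Proof.
move=> pK; have [Ks Kp] := pK; case: (eqVneq (K x0 x0) 0) => [k0|kn0].
  exists (fun=> 0); split; last by rewrite k0 mulr0.
  by apply: (eq_psd _ pK) => x y; rewrite mulr0 subr0.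
have kp : 0 < K x0 x0 by rewrite lt_neqAle eq_sym kn0 psd_diag_ge0.
pose r := Num.sqrt (K x0 x0).
have rr : r * r = K x0 x0 by rewrite -expr2 sqr_sqrtr ?ltW.
have r0 : r != 0 by rewrite sqrtr_eq0 -ltNge.
exists (fun x => K x x0 / r); split; last by rewrite -rr; field.
have := psd_comb (fun z => [:: (1, z); (- (K z x0 / K x0 x0), x0)]) pK.
apply: eq_psd => x y; rewrite /qform !big_cons !big_nil /= (Ks x0 y) -!rr.
by rewrite !addr0; field.
Qed.

(** On finitely many points a positive semidefinite kernel is a finite sum of
rank-one kernels. The remainder is kept as a kernel on all of [X], which makes
the induction over the points go through. *)
Lemma psd_peel (X : Type) (s : seq X) (K : X -> X -> R) : psd K ->
  exists vs : seq (X -> R),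
    psd (fun x y => K x y - \sum_(v <- vs) v x * v y) /\
    List.Forall (fun x => K x x = \sum_(v <- vs) v x * v x) s.
Proof.
elim: s K => [|x0 s IHs] K pK.
  exists [::]; split; last by constructor.
  by apply: (eq_psd _ pK) => x y; rewrite big_nil subr0.
have [v [pv Ev]] := psd_peel1 x0 pK; have [vs [pvs Evs]] := IHs _ pv.
have E x y : \sum_(u <- v :: vs) u x * u y = v x * v y + \sum_(u <- vs) u x * u y.
  by rewrite big_cons.
exists (v :: vs); split.
  by apply: (eq_psd _ pvs) => x y; rewrite E; ring.
(* The first step leaves [0] at [x0]; the later ones subtract squares there and
   keep the remainder nonnegative, so they subtract [0]. *)
constructor.
  have := psd_diag_ge0 x0 pvs; rewrite E Ev subrr sub0r oppr_ge0 => h.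
  suff /eqP -> : \sum_(u <- vs) u x0 * u x0 == 0 by rewrite addr0.
  rewrite eq_le h /=; apply: sumr_ge0 => u _; exact: sqr_ge0.
elim: Evs => [|x t Ex _ IH]; constructor => //.
by rewrite E -Ex; ring.
Qed.

(** The Schur product theorem: [K] can be replaced by a sum of rank-one kernels
on the points at hand, and the product with a rank-one kernel is a change of
weights. *)
Lemma psdM (X : Type) (K L : X -> X -> R) :
  psd K -> psd L -> psd (fun x y => K x y * L x y).
Proof.
move=> pK pL; split=> [x y|s]; first by rewrite (proj1 pK) (proj1 pL).
have [vs [pvs Evs]] := psd_peel [seq a.2 | a <- s] pK.
pose M := fun x y => \sum_(v <- vs) v x * v y.
have KM : forall t, List.Forall (fun x => K x x = \sum_(v <- vs) v x * v x)
    [seq a.2 | a <- t] ->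
  qform (fun x y => K x y * L x y) t s = qform (fun x y => M x y * L x y) t s.
  elim=> [|a t IHt] /=; first by rewrite /qform !big_nil.
  move=> /List.Forall_cons_iff [Ea Et]; rewrite /qform !big_cons.
  congr (_ + _); last exact: IHt.
  apply: eq_bigr => b _; congr (_ * (_ * _)); apply/eqP; rewrite -subr_eq0.
  by apply/eqP/(psd_diag0 b.2 pvs); rewrite Ea subrr.
rewrite (KM _ Evs).
have -> : qform (fun x y => M x y * L x y) s s =
  \sum_(v <- vs) qform L [seq (a.1 * v a.2, a.2) | a <- s]
                         [seq (a.1 * v a.2, a.2) | a <- s].
  rewrite /qform [RHS](_ : _ = \sum_(v <- vs) \sum_(a <- s) \sum_(b <- s)
     (a.1 * v a.2) * (b.1 * v b.2) * L a.2 b.2).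
    rewrite [RHS]exchange_big /=; apply: eq_bigr => a _.
    rewrite [RHS]exchange_big /=; apply: eq_bigr => b _.
    rewrite /M mulr_suml mulr_sumr; apply: eq_bigr => v _; ring.
  by apply: eq_bigr => v _; rewrite big_map; apply: eq_bigr => a _; rewrite big_map.
by apply: sumr_ge0 => v _; exact: (proj2 pL).
Qed.

Lemma psd_rank1 (X : Type) (v : X -> R) : psd (fun x y => v x * v y).
Proof.
have := psd_comb (fun z : X => [:: (v z, tt)]) (psd_const unit (@ler01 R)).
by apply: eq_psd => x y; rewrite /qform !big_seq1 /= mulr1.
Qed.

Lemma psd_lim (X : Type) (K : nat -> X -> X -> R) (L : X -> X -> R) :
  (forall n, psd (K n)) -> (forall x y, K n x y @[n --> \oo] --> L x y) -> psd L.
Proof.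
move=> pK KL; split=> [x y|s].
  apply: (@cvg_unique _ (@Rhausdorff R) _ _ _ _ (KL x y)).
  have -> : (fun n => K n x y) = (fun n => K n y x).
    by apply/funext => n; rewrite (proj1 (pK n)).
  exact: KL.
have cv : qform (K n) s s @[n --> \oo] --> qform L s s.
  rewrite /qform; apply: (cvg_big (op := +%R)) => [|a _]; first exact: add_continuous.
  apply: (cvg_big (op := +%R)) => [|b _]; first exact: add_continuous.
  by apply: cvgMl_tmp; exact: KL.
rewrite -(cvg_lim (@Rhausdorff R) cv); apply: limr_ge; first by apply/cvg_ex; eexists; exact: cv.
by near=> n; exact: (proj2 (pK n)).
Unshelve. all: by end_near. Qed.

Lemma psdX (X : Type) (K : X -> X -> R) n : psd K -> psd (fun x y => K x y ^+ n).
Proof.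
move=> pK; elim: n => [|n IHn].
  by apply: eq_psd (psd_const X (@ler01 R)) => x y; rewrite expr0.
by apply: eq_psd (psdM pK IHn) => x y; rewrite exprS.
Qed.

(** Limit of the partial sums of the exponential series, whose terms are Schur
powers. *)
Lemma psd_exp (X : Type) (K : X -> X -> R) : psd K -> psd (fun x y => expR (K x y)).
Proof.
move=> pK.
apply: (@psd_lim _ (fun n x y => series (exp_coeff (K x y)) n)); last first.
  by move=> x y; exact: is_cvg_series_exp_coeff.
elim=> [|n IHn].
  by apply: eq_psd (psd_const X (lexx 0)) => x y; rewrite /series /= big_geq.
have := psdD IHn (psdM (psd_const X (_ : 0 <= (n`!%:R)^-1)) (psdX n pK)).
rewrite invr_ge0 ler0n => /(_ isT); apply: eq_psd => x y.
by rewrite /series /= big_nat_recr //= /exp_coeff /= mulrC.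
Qed.

(** The form at [s] is the sum over the points [z] of the square of the total
weight at [z]. *)
Lemma psd_eqop (X : eqType) : psd (fun x y : X => (x == y)%:R).
Proof.
split=> [x y|s]; first by rewrite eq_sym.
pose t := undup [seq a.2 | a <- s].
have -> : qform (fun x y : X => (x == y)%:R) s s =
    \sum_(z <- t) (\sum_(a <- s) a.1 * (a.2 == z)%:R) ^+ 2.
  rewrite [RHS](_ : _ = \sum_(z <- t) \sum_(a <- s) \sum_(b <- s)
     a.1 * (a.2 == z)%:R * (b.1 * (b.2 == z)%:R)); last first.
    apply: eq_bigr => z _; rewrite expr2 mulr_suml; apply: eq_bigr => a _.
    by rewrite mulr_sumr.
  rewrite exchange_big /= /qform [LHS]big_seq [RHS]big_seq; apply: eq_bigr => a sa.
  rewrite exchange_big /=; apply: eq_bigr => b _.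
  have ta : a.2 \in t by rewrite mem_undup map_f.
  rewrite (bigD1_seq a.2) ?undup_uniq //= eqxx mulr1 (eq_sym b.2) big1 ?addr0.
    by rewrite mulrA.
  by move=> z; rewrite eq_sym => /negPf ->; rewrite mulr0 mul0r.
by apply: sumr_ge0 => z _; exact: sqr_ge0.
Qed.

End Kernels.

(** * Positive definite functions on groups *)

Section GroupPD.
Variables (R : realType).

(** Real-valued and symmetric: this loses nothing for approximation purposes
([haagerup_real]) and keeps complex numbers out of all constructions. *)
Definition npd (G : groupType) (f : G -> R) : Prop :=
  f 1%g = 1 /\ psd (fun u v => f (v^-1 * u)%g).

Lemma npdV (G : groupType) (f : G -> R) g : npd f -> f g^-1%g = f g.
Proof. by move=> [_ [fs _]]; have := fs 1%g g; rewrite mulg1 invg1 mul1g. Qed.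

Lemma npd_norm (G : groupType) (f : G -> R) g : npd f -> `|f g| <= 1.
Proof.
move=> [f1 pf]; have := psd_norm_le g 1%g pf.
rewrite invg1 mul1g mulg1 mulVg f1; lra.
Qed.

Lemma npd_le1 (G : groupType) (f : G -> R) g : npd f -> f g <= 1.
Proof. by move=> /(npd_norm g); apply: le_trans; exact: ler_norm. Qed.

(** Parallelogram inequality for the unit vectors at [1], [g] and [g * h], from
the weights [1], [-2] and [1]. *)
Lemma npd_mul (G : groupType) (f : G -> R) g h :
  npd f -> 1 - f (g * h)%g <= 2 * (1 - f g) + 2 * (1 - f h).
Proof.
move=> nf; have [f1 [_ pf]] := nf.
have := pf [:: (1, 1%g); (-2, g); (1, (g * h)%g)].
rewrite /qform !big_cons !big_nil /= !invg1 !mul1g !mulg1 !mulVg mulKg.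
rewrite invgM mulgVK !f1 !(npdV _ nf).
have -> : f (h^-1 * g^-1)%g = f (g * h)%g by rewrite -invgM npdV.
lra.
Qed.

Lemma npd1 (G : groupType) : npd (fun _ : G => 1).
Proof. by split=> //; exact: psd_const. Qed.

Lemma npdM (G : groupType) (f1 f2 : G -> R) :
  npd f1 -> npd f2 -> npd (fun g => f1 g * f2 g).
Proof. by move=> [e1 p1] [e2 p2]; split; [rewrite e1 e2 mulr1|exact: psdM]. Qed.

Lemma npd_prod (G : groupType) (I : Type) (s : seq I) (f : I -> G -> R) :
  (forall i, npd (f i)) -> npd (fun g => \prod_(i <- s) f i g).
Proof.
move=> nf; elim: s => [|i s IHs].
  have -> : (fun g => \prod_(i <- [::]) f i g) = (fun=> 1).
    by apply/funext => g; rewrite big_nil.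
  exact: npd1.
have -> : (fun g => \prod_(j <- i :: s) f j g) =
          (fun g => f i g * \prod_(j <- s) f j g).
  by apply/funext => g; rewrite big_cons.
exact: npdM.
Qed.

Lemma npd_comp (G G' : groupType) (h : G -> G') (f : G' -> R) :
  (forall u v, h (v^-1 * u)%g = ((h v)^-1 * h u)%g) -> npd f ->
  npd (fun g => f (h g)).
Proof.
move=> hM [f1 pf]; split; first by have := hM 1%g 1%g; rewrite !mulVg => ->.
by apply: eq_psd (psd_pull h pf) => u v; rewrite hM.
Qed.

(** Telescoping. *)
Lemma prod_dist (I : Type) (s : seq I) (a : I -> R) :
  (forall i, `|a i| <= 1) -> 1 - \prod_(i <- s) a i <= \sum_(i <- s) (1 - a i).
Proof.
move=> a1; elim: s => [|i s IHs]; first by rewrite !big_nil subrr.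
rewrite !big_cons; set p := \prod_(j <- s) a j in IHs *.
have p1 : `|p| <= 1.
  rewrite /p; elim: {IHs p} s => [|j s IHs]; first by rewrite big_nil normr1.
  by rewrite big_cons normrM mulr_ile1.
move: (a1 i) p1; rewrite !ler_norml => /andP[l1 l2] /andP[l3 l4].
apply: le_trans (_ : (1 - a i) + (1 - p) <= _); last by rewrite lerD2l.
nra.
Qed.

Definition vanishing (G : groupType) (f : G -> R) : Prop :=
  forall e : R, 0 < e -> finite_set [set g | e <= `|f g|].

(** The Haagerup property through single functions, with approximation on finite
sets instead of along a sequence. *)
Definition real_haagerup (G : groupType) : Prop :=
  forall (Q : seq G) (e : R), 0 < e ->
    exists f : G -> R, [/\ npd f, vanishing f & forall g, g \in Q -> 1 - e <= f g].

Lemma Re_sum (I : Type) (s : seq I) (F : I -> R[i]) :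
  complex.Re (\sum_(i <- s) F i) = \sum_(i <- s) complex.Re (F i).
Proof. by apply: (big_morph _ (id1 := 0)) => // -[a b] [c d]. Qed.

Lemma Im_sum (I : Type) (s : seq I) (F : I -> R[i]) :
  complex.Im (\sum_(i <- s) F i) = \sum_(i <- s) complex.Im (F i).
Proof. by apply: (big_morph _ (id1 := 0)) => // -[a b] [c d]. Qed.

Lemma posdef_qform_Re (G : groupType) (phi : G -> R[i]) (s : seq (R * G)) :
  positive_definite phi ->
  0 <= qform (fun u v => complex.Re (phi (v^-1 * u)%g)) s s.
Proof.
move=> /(_ (size s) (fun i => (tnth (in_tuple s) i).2)
             (fun i => (tnth (in_tuple s) i).1%:C%C)).
rewrite lecE => /andP[_]; rewrite raddf0 Re_sum; congr (_ <= _).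
rewrite /qform [RHS]big_tnth; apply: eq_bigr => i _.
rewrite Re_sum [RHS]big_tnth; apply: eq_bigr => j _.
case: (phi _) => x y; rewrite /= ?(mulr0, mul0r, subr0, addr0, oppr0).
by [].
Qed.

(** Take real parts far out in the sequence, and average [phi g] and [phi g^-1]
so that the symmetry of the kernel holds by construction. *)
Lemma haagerup_real (G : groupType) : haagerup R G -> real_haagerup G.
Proof.
move=> [phi [phi_pd phi_c0 phi_lim]] Q e e0.
pose f n g : R := (complex.Re (phi n g) + complex.Re (phi n g^-1%g)) / 2.
have f_npd n : npd (f n).
  have [pn p1] := phi_pd n; split.
    by rewrite /f invg1 p1 /=; lra.
  split=> [u v|s].
    by rewrite /f !invgM !invgK addrC.
  have -> : qform (fun u v => f n (v^-1 * u)%g) s s =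
     2^-1 * qform (fun u v => complex.Re (phi n (v^-1 * u)%g)) s s +
     2^-1 * qform (fun u v => complex.Re (phi n (v^-1 * u)%g)) s s.
    rewrite {2}/qform exchange_big /qform !mulr_sumr -big_split.
    apply: eq_bigr => a _; rewrite /= !mulr_sumr -big_split.
    by apply: eq_bigr => b _; rewrite /f /= invgM invgK; field.
  by rewrite addr_ge0 // mulr_ge0 ?invr_ge0 ?posdef_qform_Re.
have f_c0 n : vanishing (f n).
  move=> d d0; have fin := phi_c0 n d d0.
  apply: (@sub_finite_set _ _ ([set g | d%:C%C <= `|phi n g|] `|`
     (fun g : G => g^-1%g) @` [set g | d%:C%C <= `|phi n g|])).
    move=> g /= df.
    have := leP d `|complex.Re (phi n g)|; case=> [h1|h1].
      by left => /=; apply: le_trans (normc_ge_Re _); rewrite lecR.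
    have := leP d `|complex.Re (phi n g^-1%g)|; case=> [h2|h2].
      right; exists g^-1%g; last by rewrite invgK.
      by apply: le_trans (normc_ge_Re _); rewrite lecR.
    exfalso; have : `|f n g| <= (`|complex.Re (phi n g)| + `|complex.Re (phi n g^-1%g)|) / 2.
      by rewrite /f normrM (ger0_norm (_ : 0 <= 2^-1)) ?invr_ge0 // ler_pM2r ?ler_normD // invr_gt0.
    by move: df h1 h2; clear; lra.
  by rewrite finite_setU; split => //; exact: finite_image.
have phi_near g : \forall n \near \oo, 1 - e <= complex.Re (phi n g).
  have eC : (0 : R[i]) < e%:C%C by rewrite (ltcR 0).
  have /cvgrPdist_lt /(_ _ eC) := phi_lim g; apply: filterS => n.
  move=> /(le_lt_trans (normc_ge_Re _)); rewrite ltcR.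
  by case: (phi n g) => a b /=; rewrite ltr_norml => /andP[_]; lra.
have : \forall n \near \oo, forall g, g \in Q -> 1 - e <= f n g.
  elim: Q => [|g Q IHQ]; first by apply: nearW.
  have := phi_near g; have := phi_near g^-1%g; move: IHQ.
  apply: filterS3 => n h1 h2 h3 g'; rewrite inE => /orP[/eqP ->|/h1//].
  by rewrite /f; lra.
move=> [n _ /(_ n (leqnn n)) hn].
by exists (f n).
Qed.
End GroupPD.

(** * A criterion for the Haagerup property *)

Section Criterion.
Variable R : realType.

Lemma normc_realE (x : R) : `|x%:C%C| = `|x|%:C%C.
Proof. by rewrite normc_def /= expr0n addr0 sqrtr_sqr. Qed.

(** For complex weights [a + i b] the form is the sum of the real forms at [a]
and at [b]; the imaginary part vanishes by symmetry. *)
Lemma npd_complex (G : groupType) (f : G -> R) :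
  npd f -> positive_definite (fun g => (f g)%:C%C).
Proof.
move=> [_ [fs fp]] n g c.
pose ca i := complex.Re (c i); pose cb i := complex.Im (c i).
have E (d : 'I_n -> R) : 0 <= \sum_(i < n) \sum_(j < n) d i * d j * f ((g j)^-1 * g i)%g.
  have := fp [seq (d i, g i) | i <- index_enum 'I_n].
  rewrite /qform big_map; congr (0 <= _); apply: eq_bigr => i _.
  by rewrite big_map.
have conjE (z : R[i]) : z^* = (complex.Re z -i* complex.Im z)%C by case: z.
rewrite lecE Im_sum Re_sum; apply/andP; split; last first.
  rewrite raddf0; have := addr_ge0 (E ca) (E cb); congr (0 <= _).
  rewrite -big_split; apply: eq_bigr => i _; rewrite Re_sum -big_split /=.
  apply: eq_bigr => j _; rewrite conjE /ca /cb.
  case: (c i) (c j) => [a b] [a' b'] /=; ring.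
rewrite raddf0; apply/eqP.
pose S := \sum_(i < n) \sum_(j < n) (cb i * ca j - ca i * cb j) * f ((g j)^-1 * g i)%g.
have -> : \sum_(i < n) complex.Im (\sum_(j < n) c i * (c j)^* * (f ((g j)^-1 * g i)%g)%:C%C) = S.
  apply: eq_bigr => i _; rewrite Im_sum; apply: eq_bigr => j _.
  rewrite conjE /ca /cb; case: (c i) (c j) => [a b] [a' b'] /=; ring.
have : S = - S.
  rewrite {1}/S exchange_big /= /S -sumrN; apply: eq_bigr => i _.
  rewrite -sumrN; apply: eq_bigr => j _; rewrite (fs (g j)); ring.
lra.
Qed.

Lemma geom_tail N n : (N <= n)%N ->
  \sum_(N <= k < n) (2^-1 : R) ^+ k.+1 <= 2^-1 ^+ N.
Proof.
move=> Nn; suff -> : \sum_(N <= k < n) (2^-1 : R) ^+ k.+1 = 2^-1 ^+ N - 2^-1 ^+ n.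
  by rewrite lerBlDr lerDl exprn_ge0 // invr_ge0.
rewrite -(subnKC Nn); elim: (n - N)%N => [|m IHm].
  by rewrite addn0 big_geq // subrr.
rewrite addnS big_nat_recr ?leq_addr //= IHm !exprS.
by field.
Qed.

(** Choose [f n] within [2^-(n + 2)] of [1] on the first [n] elements of the
group, so that the squares [h n] satisfy [1 - h n <= 2^-(n + 1)] there. The tail
products [\prod_(N <= k) h k] are limits of positive definite functions, tend to
[1] as [N] grows, and are below [c ^+ K] away from the finite sets where one of
[h N], ..., [h (N + K - 1)] exceeds [c]. *)
Lemma haagerup_criterion (G : groupType) (c : R) : countable [set: G] ->
  0 <= c < 1 ->
  (forall (Q : seq G) (e : R), 0 < e -> exists f : G -> R,
    [/\ npd f, finite_set [set g | c < `|f g|] &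
        forall g, g \in Q -> 1 - e <= f g]) ->
  haagerup R G.
Proof.
move=> Gcount /andP[c_ge0 c_lt1] weak.
have [u u_surj] : exists u : nat -> G, forall t, exists n, u n = t.
  move: Gcount => /countable_injP[i inj_i].
  have /choice[u uP] : forall n, exists t : G, forall t', i t' = n -> t' = t.
    move=> n; case: (pselect (exists t, i t = n)) => [[t tn]|no].
      by exists t => t' t'n; apply: inj_i; rewrite ?inE // t'n tn.
    by exists 1%g => t' t'n; case: no; exists t'.
  by exists u => t; exists (i t); rewrite -(uP _ t).
have e_gt0 n : 0 < (2^-1 : R) ^+ n.+2 by rewrite exprn_gt0 // invr_gt0.
have /choice[f fP] := fun n => weak [seq u k | k <- iota 0 n] _ (e_gt0 n).
pose h n g := f n g * f n g.
have h_npd n : npd (h n) by have [? _ _] := fP n; exact: npdM.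
have h_ge0 n g : 0 <= h n g by rewrite /h -expr2 sqr_ge0.
have h_le1 n g : h n g <= 1 by exact: npd_le1.
have h_fin n : finite_set [set g | c < h n g].
  have [nf fin _] := fP n; apply: sub_finite_set fin => g /= ch.
  apply: (lt_le_trans ch); rewrite /h.
  apply: le_trans (ler_norm _) _; rewrite normrM.
  by rewrite ler_piMr // npd_norm.
have h_near n g : g \in [seq u k | k <- iota 0 n] -> 1 - h n g <= 2^-1 ^+ n.+1.
  have [nf _ fQ] := fP n; move=> /fQ hf; have := npd_le1 g nf.
  have -> : (2^-1 : R) ^+ n.+1 = 2 * 2^-1 ^+ n.+2 by rewrite [in RHS]exprS mulVKf.
  rewrite /h; move: hf (e_gt0 n).
  set d := _ ^+ _; set x := f n g; clearbody d x; clear; nra.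
pose F N n g := \prod_(N <= k < n) h k g.
have F_npd N n : npd (F N n) by exact: npd_prod.
have F_ge0 N n g : 0 <= F N n g by apply: prodr_ge0.
have F_noninc N g : nonincreasing_seq (fun n => F N n g).
  apply/nonincreasing_seqP => n; rewrite /F.
  have [Nn|nN] := leqP N n; last by rewrite !big_geq ?(ltnW nN).
  by rewrite big_nat_recr //= ler_piMr ?h_le1 //; exact: F_ge0.
have F_cvg N g : cvgn (fun n => F N n g).
  by apply: nonincreasing_is_cvgn => //; exists 0 => _ [n _ <-].
pose L N g := limn (fun n => F N n g).
have LF N g : F N n g @[n --> \oo] --> L N g by exact: F_cvg.
have L_npd N : npd (L N).
  split.
    rewrite /L (_ : (fun n => F N n 1%g) = fun=> 1); last first.
      by apply/funext => n; exact: (proj1 (F_npd N n)).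
    by rewrite lim_cst.
  apply: (@psd_lim _ _ (fun n u v => F N n (v^-1 * u)%g)) => [n|x y].
    exact: (proj2 (F_npd N n)).
  exact: LF.
have L_le N n g : L N g <= F N n g by apply: nonincreasing_cvgn_ge.
have L_ge0 N g : 0 <= L N g by apply: limr_ge => //; exact: nearW.
exists (fun N g => (L N g)%:C%C); split.
- by move=> N; split; [exact: npd_complex|rewrite (proj1 (L_npd N))].
- move=> N e e0.
  have [K cK] : exists K, c ^+ K < e.
    have : (fun n => c ^+ n : R) @ \oo --> (0 : R).
      by apply: cvg_expr; rewrite ger0_norm.
    move=> /cvgrPdist_lt /(_ _ e0) [K _ /(_ K (leqnn K))] /=.
    by rewrite sub0r normrN ger0_norm ?exprn_ge0 // => ?; exists K.
  apply: (@sub_finite_set _ _ (\bigcup_(k in `I_(N + K)) [set g | c < h k g])); last first.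
    by apply: bigcup_finite => //; exact: finite_II.
  move=> g /=; rewrite normc_realE lecR ger0_norm // => eL.
  apply: contrapT => no; move: eL; apply/negP; rewrite -ltNge.
  apply: le_lt_trans (L_le N (N + K)%N g) _; apply: le_lt_trans cK.
  have -> : c ^+ K = \prod_(N <= k < N + K) c by rewrite prodr_const_nat addKn.
  rewrite /F !big_nat; apply: ler_prod => k /andP[_ kK].
  rewrite h_ge0 /= leNgt; apply/negP => ch; apply: no; by exists k.
- move=> g; have [i ui] := u_surj g.
  apply/cvgrPdist_lt => e; rewrite ltcE /= => /andP[/eqP ei e0].
  have : (fun n => 2^-1 ^+ n : R) @ \oo --> (0 : R).
    by apply: cvg_expr; rewrite ger0_norm ?invr_ge0 // invf_lt1 // ltr1n.
  move=> /cvgrPdist_lt /(_ _ e0) small.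
  have : \forall N \near \oo, (i < N)%N by exists i.+1.
  apply: filterS2 small => N; rewrite sub0r normrN => small iN.
  have -> : (1 : R[i]) - (L N g)%:C%C = (1 - L N g)%:C%C by rewrite rmorphB.
  rewrite normc_realE ltcE /= ei eqxx /=; apply: le_lt_trans small.
  rewrite (ger0_norm (exprn_ge0 _ _)) ?invr_ge0 // ger0_norm ?subr_ge0 ?(npd_le1 _ (L_npd N)) //.
  rewrite lerBlDr addrC -lerBlDr; apply: limr_ge => //.
  have : \forall n \near \oo, (N <= n)%N by exists N.
  apply: filterS => n Nn.
  rewrite lerBlDr addrC -lerBlDr; apply: le_trans (geom_tail Nn).
  apply: le_trans (prod_dist _ _) _.
    by move=> k; rewrite ger0_norm.
  rewrite !big_nat; apply: ler_sum => k /andP[Nk _]; apply: h_near.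
  by rewrite -ui map_f // mem_iota /= add0n (leq_trans iN).
Qed.
End Criterion.

(** * Random phases and damping *)

Section Phases.
Variables (R : realType) (G : groupType).

Section Damping.
Implicit Types (K : seq G -> seq G -> R) (y z : G) (s t : seq G).

(** The kernels [K s t] on words that only depend on the difference of [s] and
[t] in the free abelian group on [G]; as functions on that group they stand for
expectations of monomials in the phases. *)
Definition shiftinv K : Prop :=
  (forall s s' t t', perm_eq s s' -> perm_eq t t' -> K s t = K s' t') /\
  (forall y s t, K (y :: s) (y :: t) = K s t).

(** Multiplication by [|(1 + U_y) / 2| ^ 2], where a letter [y] on the left
stands for [U_y] and a letter [y] on the right for its conjugate. *)
Definition damp y K s t : R :=
  (K s t + K (y :: s) (y :: t) + K (y :: s) t + K s (y :: t)) / 4.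

(** Multiplication by [|(1 - U_y) / 2| ^ 2]. *)
Definition codamp y K s t : R :=
  (K s t + K (y :: s) (y :: t) - K (y :: s) t - K s (y :: t)) / 4.

Definition damps (ys : seq G) K : seq G -> seq G -> R := foldr damp K ys.

Lemma perm_swap2 y z s : perm_eq (y :: z :: s) (z :: y :: s).
Proof. by rewrite (perm_catCA [:: y] [:: z] s). Qed.

Lemma shiftinv_damp y K : shiftinv K -> shiftinv (damp y K).
Proof.
move=> [Kp Ks]; split=> [s s' t t' ss tt|z s t]; rewrite /damp.
  by rewrite (Kp _ _ _ _ ss tt) (Kp (y :: s) (y :: s') (y :: t) (y :: t'))
    ?perm_cons // (Kp (y :: s) (y :: s') t t') ?perm_cons //
    (Kp s s' (y :: t) (y :: t')) ?perm_cons.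
rewrite !Ks (Kp _ _ _ _ (perm_swap2 y z s) (perm_refl (z :: t))).
by rewrite (Kp _ _ _ _ (perm_refl (z :: s)) (perm_swap2 y z t)) !Ks.
Qed.

Lemma shiftinv_damps ys K : shiftinv K -> shiftinv (damps ys K).
Proof. by move=> K_inv; elim: ys => //= y ys; exact: shiftinv_damp. Qed.

Lemma damp_codamp y K s t : shiftinv K -> damp y K s t + codamp y K s t = K s t.
Proof. by move=> [_ Ks]; rewrite /damp /codamp Ks; field. Qed.

Lemma dampC y z K : shiftinv K -> damp y (damp z K) = damp z (damp y K).
Proof.
move=> [Kp Ks]; apply/funext => s; apply/funext => t; rewrite /damp !Ks.
rewrite !(Kp _ _ _ _ (perm_swap2 y z s) (perm_refl _)).
rewrite !(Kp _ _ _ _ (perm_refl _) (perm_swap2 y z t)) !Ks.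
have -> : K (z :: y :: s) (y :: t) = K (z :: s) t.
  by rewrite (Kp _ _ _ _ (perm_swap2 z y s) (perm_refl _)) Ks.
have -> : K (y :: s) (z :: y :: t) = K s (z :: t).
  by rewrite (Kp _ _ _ _ (perm_refl _) (perm_swap2 z y t)) Ks.
by congr (_ / _); ring.
Qed.

Lemma damps_cons_cat y ys zs K : shiftinv K ->
  damps (ys ++ y :: zs) K = damp y (damps (ys ++ zs) K).
Proof.
move=> K_inv; elim: ys => //= z ys ->; apply: dampC; exact: shiftinv_damps.
Qed.

Lemma damps_perm ys zs K : shiftinv K -> perm_eq ys zs -> damps ys K = damps zs K.
Proof.
move=> K_inv; elim: ys zs => [|y ys IHys] zs.
  by rewrite perm_sym => /perm_nilP ->.
move=> yz; have : y \in zs by rewrite -(perm_mem yz) mem_head.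
move=> /path.splitPr eqz; case: eqz yz => z1 z2 yz.
rewrite damps_cons_cat //= (IHys (z1 ++ z2)) //.
by move: yz; rewrite -[y :: z2]cat1s perm_sym perm_catCA perm_cons perm_sym.
Qed.

Lemma damps_damp ys y K : shiftinv K -> damps ys (damp y K) = damp y (damps ys K).
Proof.
by move=> K_inv; have := damps_cons_cat y ys [::] K_inv; rewrite cats0 => <-;
  rewrite /damps foldr_cat.
Qed.

Variable X : Type.

Definition xdamp y (N : X * seq G -> X * seq G -> R) p q : R :=
  damp y (fun s t => N (p.1, s) (q.1, t)) p.2 q.2.
Definition xcodamp y (N : X * seq G -> X * seq G -> R) p q : R :=
  codamp y (fun s t => N (p.1, s) (q.1, t)) p.2 q.2.

Lemma psd_xdamp y N : psd N -> psd (xdamp y N).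
Proof.
move=> /(psd_comb (fun p => [:: (2^-1, p); (2^-1, (p.1, y :: p.2))])).
apply: eq_psd => -[x s] [x' t].
by rewrite /xdamp /damp /qform !big_cons !big_nil /=; field.
Qed.

Lemma psd_xcodamp y N : psd N -> psd (xcodamp y N).
Proof.
move=> /(psd_comb (fun p => [:: (2^-1, p); (- 2^-1, (p.1, y :: p.2))])).
apply: eq_psd => -[x s] [x' t].
by rewrite /xcodamp /codamp /qform !big_cons !big_nil /=; field.
Qed.

(** Only the letters [y] that separate the two points are damped. One step of
the induction reads [damp y N + [c y p = c y q] * codamp y N], which is [N] if
the points are not separated by [y] and [damp y N] if they are; both terms are
positive semidefinite. *)
Lemma psd_damps_sep (T : eqType) (c : G -> X -> T) (ys : seq G) K :
  psd K -> shiftinv K ->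
  psd (fun p q : X * seq G =>
         damps [seq y <- ys | c y p.1 != c y q.1] K p.2 q.2).
Proof.
move=> pK K_inv; elim: ys => [|y ys IHys] /=.
  exact: (psd_pull snd pK).
have pc : psd (fun p q : X * seq G => (c y p.1 == c y q.1)%:R : R).
  exact: (psd_pull (fun p : X * seq G => c y p.1) (psd_eqop R T)).
apply: eq_psd (psdD (psd_xdamp y IHys) (psdM pc (psd_xcodamp y IHys))).
move=> [x s] [x' t]; rewrite /xdamp /xcodamp /=.
case: eqP => /= _; last by rewrite mul0r addr0.
by rewrite mul1r damp_codamp //; exact: shiftinv_damps.
Qed.

End Damping.

Lemma psd_damp y (K : seq G -> seq G -> R) : psd K -> psd (damp y K).
Proof.
move=> /(psd_comb (fun s => [:: (2^-1, s); (2^-1, y :: s)])).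
apply: eq_psd => s t.
by rewrite /damp /qform !big_cons !big_nil /=; field.
Qed.

Lemma psd_codamp y (K : seq G -> seq G -> R) : psd K -> psd (codamp y K).
Proof.
move=> /(psd_comb (fun s => [:: (2^-1, s); (- 2^-1, y :: s)])).
apply: eq_psd => s t.
by rewrite /codamp /qform !big_cons !big_nil /=; field.
Qed.

Lemma psd_damps ys (K : seq G -> seq G -> R) : psd K -> psd (damps ys K).
Proof. by move=> pK; elim: ys => //= y ys; exact: psd_damp. Qed.

(** The product of the damping factors is at most [1]. *)
Lemma psd_sub_damps ys (K : seq G -> seq G -> R) : psd K -> shiftinv K ->
  psd (fun s t => K s t - damps ys K s t).
Proof.
move=> pK K_inv; elim: ys => [|y ys IHys] /=.
  by apply: eq_psd (psd_const _ (lexx 0)) => s t; rewrite subrr.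
apply: eq_psd (psdD IHys (psd_codamp y (psd_damps ys pK))) => s t.
by rewrite -(damp_codamp y s t (shiftinv_damps ys K_inv)); ring.
Qed.

(** If [-A <= B <= A] as kernels, then the entries of [B] are bounded by the
diagonal of [A]. *)
Lemma psd_dom (X : Type) (A B : X -> X -> R) x y :
  psd (fun x y => A x y - B x y) -> psd (fun x y => A x y + B x y) ->
  2 * `|B x y| <= A x x + A y y.
Proof.
move=> pm pp.
have := qform2 1 1 x y pm; have := qform2 1 (-1) x y pm.
have := qform2 1 1 x y pp; have := qform2 1 (-1) x y pp.
by case: (ger0P (B x y)) => _; lra.
Qed.

Section Phase.
Variable phi : G -> R.
Hypothesis phi_npd : npd phi.

(** The inner product of [\sum_(y <- s) e_y] and [\sum_(z <- t) e_z], for unit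
vectors [e_y] with Gram kernel [phi]. *)
Definition gram (s t : seq G) : R := \sum_(y <- s) \sum_(z <- t) phi (z^-1 * y)%g.

(** The expectation of [\prod_(y <- s) U_y * \prod_(z <- t) conj U_z]; the
exponent is minus the squared distance of the two vectors of [gram]. The factor
on sizes is the effect of rotating all the phases by a common uniform angle. *)
Definition phase (s t : seq G) : R :=
  (size s == size t)%:R * expR (2 * gram s t - gram s s - gram t t).

Lemma psd_gram : psd gram.
Proof.
have := psd_comb (fun s => [seq (1, y) | y <- s]) (proj2 phi_npd).
apply: eq_psd => s t; rewrite /gram /qform big_map; apply: eq_bigr => y _.
by rewrite big_map; apply: eq_bigr => z _; rewrite /= !mul1r.
Qed.

Lemma gramC s t : gram s t = gram t s.
Proof. exact: (proj1 psd_gram). Qed.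

Lemma psd_phase : psd phase.
Proof.
have p1 := psd_pull (@size G) (psd_eqop R nat).
have p2 := psd_exp (psdM (psd_const (seq G) (ler0n R 2)) psd_gram).
have p3 := psd_rank1 (fun s => expR (- gram s s)).
apply: eq_psd (psdM p1 (psdM p2 p3)) => s t.
by rewrite /phase -!expRD; congr (_ * expR _); ring.
Qed.

Let row y (t : seq G) : R := \sum_(z <- t) phi (z^-1 * y)%g.

Lemma gram_consl y s t : gram (y :: s) t = row y t + gram s t.
Proof. by rewrite /gram big_cons. Qed.

Lemma gram_consr y s t : gram s (y :: t) = row y s + gram s t.
Proof. by rewrite gramC gram_consl gramC. Qed.

Lemma row_cons y z t : row y (z :: t) = phi (z^-1 * y)%g + row y t.
Proof. by rewrite /row big_cons. Qed.

Lemma gram_perm s s' t t' : perm_eq s s' -> perm_eq t t' -> gram s t = gram s' t'.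
Proof.
move=> ss tt; rewrite /gram (perm_big _ ss) /=; apply: eq_bigr => y _.
exact: perm_big.
Qed.

Lemma shiftinv_phase : shiftinv phase.
Proof.
split=> [s s' t t' ss tt|y s t]; rewrite /phase.
  rewrite (perm_size ss) (perm_size tt).
  by rewrite (gram_perm ss tt) (gram_perm ss ss) (gram_perm tt tt).
have E : 2 * gram (y :: s) (y :: t) - gram (y :: s) (y :: s) - gram (y :: t) (y :: t) =
         2 * gram s t - gram s s - gram t t.
  rewrite !gram_consl !gram_consr !row_cons mulVg (proj1 phi_npd).
  by move: (row y s) (row y t) => *; ring.
by rewrite E [size _]/= [size (y :: t)]/= eqSS.
Qed.

Lemma gram_nseq j i x y : gram (nseq j x) (nseq i y) = j%:R * i%:R * phi (y^-1 * x)%g.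
Proof.
rewrite /gram big_nseq iter_addr_0 big_nseq iter_addr_0.
by rewrite -mulrA !mulr_natl.
Qed.

Variable m : nat.

(** The expectation of [u_x * conj u_y * \prod_(z <- ys) |(1 + U_z) / 2| ^ 2],
where [u_x] is [(m + 1)^(-1/2)] times the sum of the [U_x ^ j], [j <= m]. *)
Definition wave (ys : seq G) (x y : G) : R :=
  m.+1%:R^-1 * \sum_(0 <= j < m.+1) \sum_(0 <= i < m.+1)
     damps ys phase (nseq j x) (nseq i y).

Lemma wave_psd_aux (X : Type) (g : X -> G) (N : X * seq G -> X * seq G -> R) :
  psd N ->
  psd (fun u v => m.+1%:R^-1 * \sum_(0 <= j < m.+1) \sum_(0 <= i < m.+1)
     N (u, nseq j (g u)) (v, nseq i (g v))).
Proof.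
move=> /(psd_comb (fun u => [seq (1, (u, nseq j (g u))) | j <- index_iota 0 m.+1])).
move=> /(psdM (psd_const X (_ : 0 <= m.+1%:R^-1))); rewrite invr_ge0 ler0n => /(_ isT).
apply: eq_psd => u v; congr (_ * _); rewrite /qform big_map; apply: eq_bigr => j _.
by rewrite big_map; apply: eq_bigr => i _; rewrite /= !mul1r.
Qed.

Lemma wave_psd_aux1 (N : seq G -> seq G -> R) :
  psd N ->
  psd (fun u v => m.+1%:R^-1 * \sum_(0 <= j < m.+1) \sum_(0 <= i < m.+1)
     N (nseq j u) (nseq i v)).
Proof. by move=> pN; apply: (wave_psd_aux id (psd_pull snd pN)). Qed.

Lemma wave_perm ys zs x y : perm_eq ys zs -> wave ys x y = wave zs x y.
Proof. by move=> yz; rewrite /wave (damps_perm shiftinv_phase yz). Qed.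

(** Keeping only the damping factor of one letter [z] of [ys] gives a larger
kernel. *)
Lemma wave_bound ys z x y : z \in ys ->
  2 * `|wave ys x y| <= wave [:: z] x x + wave [:: z] y y.
Proof.
move=> zys; have yz := perm_to_rem zys.
rewrite (wave_perm x y yz); set zs := rem z ys.
have pd := psd_damp z psd_phase; have di := shiftinv_damp z shiftinv_phase.
have E : damps (z :: zs) phase = damps zs (damp z phase).
  by rewrite (damps_damp _ _ shiftinv_phase).
apply: psd_dom.
  apply: eq_psd (wave_psd_aux1 (psd_sub_damps zs pd di)) => u v.
  rewrite /wave E -mulrBr; congr (_ * _); rewrite -sumrB; apply: eq_bigr => j _.
  by rewrite -sumrB.
apply: eq_psd (wave_psd_aux1 (psdD pd (psd_damps zs pd))) => u v.
rewrite /wave E -mulrDr; congr (_ * _); rewrite -big_split; apply: eq_bigr => j _.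
by rewrite -big_split.
Qed.

Lemma phase_nseq j i x y : phase (nseq j x) (nseq i y) =
  (i == j)%:R * expR (- (2 * j%:R ^+ 2 * (1 - phi (y^-1 * x)%g))).
Proof.
rewrite /phase !size_nseq eq_sym; case: eqP => [->|_]; last by rewrite !mul0r.
rewrite !gram_nseq !mulVg (proj1 phi_npd); congr (_ * expR _); ring.
Qed.

Lemma phase_nseq1 j i x y : phase (y :: nseq j x) (nseq i x) =
  (i == j.+1)%:R * expR (- (2 * (1 - phi (x^-1 * y)%g))).
Proof.
rewrite /phase /= !size_nseq eq_sym; case: eqP => [->|_]; last by rewrite !mul0r.
rewrite !gram_consl !gram_consr !row_cons !gram_nseq !mulVg (proj1 phi_npd).
rewrite /row !big_nseq !iter_addr_0 -!(mulr_natl (phi _)) -natr1.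
by congr (_ * expR _); move: (phi _) => *; ring.
Qed.

Lemma sum_pick n (F : nat -> R) i :
  \sum_(0 <= j < n) (j == i)%:R * F j = (i < n)%:R * F i.
Proof.
elim: n => [|n IHn]; first by rewrite big_geq // ltn0 mul0r.
rewrite big_nat_recr //= IHn ltnS (leq_eqVlt i n) (eq_sym i).
case: eqP => [->|_]; last by rewrite mul0r addr0.
by rewrite ltnn mul0r add0r.
Qed.

(** The term of index [j] of the diagonal sum is [expR (- 2 * j ^ 2 * (1 - phi
(y^-1 * x)))]; the others vanish. *)
Lemma wave_nil x y : 1 - 2 * m%:R ^+ 2 * (1 - phi (y^-1 * x)%g) <= wave [::] x y.
Proof.
rewrite /wave /=; set d := 1 - phi _.
have d0 : 0 <= d by rewrite subr_ge0 npd_le1.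
rewrite [leRHS]mulrC ler_pdivlMr ?ltr0n //.
have -> : (1 - 2 * m%:R ^+ 2 * d) * m.+1%:R =
    \sum_(0 <= j < m.+1) (1 - 2 * m%:R ^+ 2 * d).
  by rewrite sumr_const_nat subn0 mulr_natr.
rewrite !big_nat; apply: ler_sum => j /andP[_ jm].
under eq_bigr => i _ do rewrite phase_nseq.
rewrite sum_pick jm mul1r.
apply: le_trans (expR_ge1Dx _); rewrite lerD2l lerN2.
apply: ler_wpM2r => //; apply: ler_wpM2l => //.
by rewrite lerXn2r ?nnegrE ?ler_nat.
Qed.

Lemma wave_nil1 x : wave [::] x x = 1.
Proof.
rewrite /wave /= (_ : \sum_(0 <= j < m.+1) _ = m.+1%:R) ?mulVf ?pnatr_eq0 //.
transitivity (\sum_(0 <= j < m.+1) (1 : R)); last by rewrite sumr_const_nat subn0.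
rewrite !big_nat; apply: eq_bigr => j /andP[_ jm].
under eq_bigr => i _ do rewrite phase_nseq.
by rewrite sum_pick jm mulVg (proj1 phi_npd) subrr mulr0 oppr0 expR0 mul1r.
Qed.

(** [|u_x| ^ 2] has Fourier coefficients [1] at [0] and [m / (m + 1)] at [1] and
[-1], and [|(1 + U_y) / 2| ^ 2] has [1 / 2] and [1 / 4]. *)
Lemma wave1 x y : wave [:: y] x x =
  (1 + m%:R / m.+1%:R * expR (- (2 * (1 - phi (x^-1 * y)%g)))) / 2.
Proof.
rewrite /wave /= /damp; set e := expR _.
have K0 j i : phase (nseq j x) (nseq i x) = (i == j)%:R * 1.
  by rewrite phase_nseq mulVg (proj1 phi_npd) subrr mulr0 oppr0 expR0.
have K1 j i : phase (nseq j x) (y :: nseq i x) = (j == i.+1)%:R * e.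
  by rewrite (proj1 psd_phase) phase_nseq1.
have S1 : \sum_(0 <= j < m.+1) \sum_(0 <= i < m.+1) phase (nseq j x) (nseq i x) = m.+1%:R.
  transitivity (\sum_(0 <= j < m.+1) (1 : R)); last by rewrite sumr_const_nat subn0.
  rewrite !big_nat; apply: eq_bigr => j /andP[_ jm].
  under eq_bigr => i _ do rewrite K0.
  by rewrite sum_pick jm mul1r.
have S2 : \sum_(0 <= j < m.+1) \sum_(0 <= i < m.+1) phase (y :: nseq j x) (nseq i x)
     = m%:R * e.
  under eq_bigr => j _ do under eq_bigr => i _ do rewrite phase_nseq1.
  under eq_bigr => j _ do rewrite sum_pick ltnS.
  rewrite big_nat_recr //= ltnn mul0r addr0.
  transitivity (\sum_(0 <= j < m) e); last by rewrite sumr_const_nat subn0 mulr_natl.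
  by rewrite !big_nat; apply: eq_bigr => j /andP[_ ->]; rewrite mul1r.
have S3 : \sum_(0 <= j < m.+1) \sum_(0 <= i < m.+1) phase (nseq j x) (y :: nseq i x)
     = m%:R * e.
  rewrite exchange_big -S2; apply: eq_bigr => j _; apply: eq_bigr => i _.
  exact: (proj1 psd_phase).
transitivity (m.+1%:R^-1 * ((m.+1%:R + m.+1%:R + m%:R * e + m%:R * e) / 4)).
  congr (_ * _); rewrite -{1 2}S1 -{1}S2 -S3 -!big_split /= mulr_suml.
  apply: eq_bigr => j _; rewrite -!big_split /= mulr_suml; apply: eq_bigr => i _.
  by rewrite (proj2 shiftinv_phase).
by field; rewrite ?(nat1r, natr1) pnatr_eq0.
Qed.

Lemma wave1_ge x y : 1 - (m.+1%:R^-1 + (1 - phi (x^-1 * y)%g)) <= wave [:: y] x x.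
Proof.
rewrite wave1; set d := 1 - phi _.
have d0 : 0 <= d by rewrite subr_ge0 npd_le1.
have := expR_ge1Dx (- (2 * d)).
have -> : m%:R / m.+1%:R = 1 - m.+1%:R^-1 :> R.
  by rewrite -natr1; field; rewrite ?(nat1r, natr1) pnatr_eq0.
have h0 : 0 <= m.+1%:R^-1 :> R by rewrite invr_ge0.
have h1 : m.+1%:R^-1 <= 1 :> R by rewrite invf_le1 ?ler1n ?ltr0n.
move: h0 h1; set i := _^-1; set e := expR _; clearbody i e d; nra.
Qed.

(** Far indices decorrelate: [expR (-1) <= 1 / 2]. *)
Lemma wave1_le x y : phi (x^-1 * y)%g <= 2^-1 -> wave [:: y] x x <= 3 / 4.
Proof.
move=> phi_le; rewrite wave1.
have e1 : expR (- 1) <= 2^-1 :> R.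
  by rewrite expRN lef_pV2 ?posrE ?expR_gt0 // -[2]/(1 + 1); exact: expR_ge1Dx.
have : expR (- (2 * (1 - phi (x^-1 * y)%g))) <= 2^-1.
  apply: le_trans e1; rewrite ler_expR lerN2.
  by move: phi_le; set p := phi _; clearbody p; lra.
set e := expR _ => he.
have e0 : 0 <= e by exact: expR_ge0.
have : m%:R / m.+1%:R * e <= e.
  by apply: ler_piMl => //; rewrite ler_pdivrMr ?ltr0n // mul1r ler_nat.
by move: he; set w := _ * e; clearbody w e; lra.
Qed.

Lemma phase_map g s t : phase [seq (g * y)%g | y <- s] [seq (g * y)%g | y <- t] = phase s t.
Proof.
have E a b : gram [seq (g * y)%g | y <- a] [seq (g * y)%g | y <- b] = gram a b.
  rewrite /gram big_map; apply: eq_bigr => y _; rewrite big_map.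
  by apply: eq_bigr => z _; rewrite invgM -mulgA mulKg.
by rewrite /phase !size_map !E.
Qed.

Lemma damps_map g ys s t :
  damps [seq (g * y)%g | y <- ys] phase [seq (g * y)%g | y <- s] [seq (g * y)%g | y <- t]
  = damps ys phase s t.
Proof.
elim: ys s t => [|y ys IHys] s t /=; first exact: phase_map.
by rewrite /damp IHys -!map_cons !IHys.
Qed.

Lemma wave_map g ys x y : wave [seq (g * z)%g | z <- ys] (g * x)%g (g * y)%g = wave ys x y.
Proof.
rewrite /wave; apply: (congr1 (fun z => _ * z)); apply: eq_bigr => j _.
by apply: eq_bigr => i _; rewrite -(damps_map g ys) !map_nseq.
Qed.

End Phase.
End Phases.

(** * Commutators and the derived subgroup *)

Section CommutatorCalculus.
Local Open Scope group_scope.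

Definition central (T : groupType) (z : T) : Prop := forall x, commute x z.

Definition class2 (T : groupType) : Prop := forall x y : T, central (comm x y).

Lemma comm1P (T : groupType) (x y : T) : comm x y = 1 <-> commute x y.
Proof.
rewrite /comm; split=> [h|xy]; last by rewrite xy mulgK mulgV.
by rewrite /commute -{2}(divg1_eq h) mulgVK.
Qed.

Lemma commMl (T : groupType) (x x' y : T) :
  comm (x * x') y = x * comm x' y * x^-1 * comm x y.
Proof. by rewrite /comm invgM !mulgA !mulgVK. Qed.

Lemma commMr (T : groupType) (x y y' : T) :
  comm x (y * y') = comm x y * (y * comm x y' * y^-1).
Proof. by rewrite /comm invgM !mulgA !mulgVK. Qed.

Lemma central1 (T : groupType) : central (1 : T).
Proof. by move=> x; exact: commute1. Qed.

Lemma centralM (T : groupType) (x y : T) : central x -> central y -> central (x * y).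
Proof. by move=> cx cy z; exact: commuteM. Qed.

Lemma centralJ (T : groupType) (x z : T) : central z -> x * z * x^-1 = z.
Proof. by move=> cz; rewrite cz mulgK. Qed.

Definition derived (H : groupType) : normalSubgroup H :=
  normal_closure [set z : H | exists a b, z = comm a b].

Lemma derived_comm (H : groupType) (a b : H) : derived H (comm a b).
Proof. by move=> N; apply; exists a, b. Qed.

(** The image of a commutator is a commutator of central elements, and the
kernel is a normal subgroup. *)
Lemma central_hom_derived (H T : groupType) (f : H -> T) :
  (forall a b, f (a * b) = f a * f b) -> (forall a, central (f a)) ->
  forall d, derived H d -> f d = 1.
Proof.
move=> fM fc d Dd.
have f1 : f 1 = 1 by apply: (mulgI (f 1)); rewrite -fM !mulg1.
have fV a : f a^-1 = (f a)^-1 by apply: (mulgI (f a)); rewrite -fM !mulgV.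
have k1 : [set a | f a = 1] 1 by [].
have kM a b : [set a | f a = 1] a -> [set a | f a = 1] b -> [set a | f a = 1] (a * b).
  by rewrite /= fM => -> ->; rewrite mulg1.
have kV a : [set a | f a = 1] a -> [set a | f a = 1] a^-1.
  by rewrite /= fV => ->; rewrite invg1.
have kJ a b : [set a | f a = 1] a -> [set a | f a = 1] (b * a * b^-1).
  by rewrite /= !fM fV => ->; rewrite mulg1 mulgV.
apply: (Dd (NormalSubgroup k1 kM kV kJ)) => _ [a [b ->]] /=.
by rewrite /comm !fM !fV; apply/comm1P; exact: fc.
Qed.
End CommutatorCalculus.

(** * Structure of the second nilpotent product *)

Section Nil2.
Local Open Scope group_scope.
Variables (I : choiceType) (H : groupType).
Local Notation Hs := (fun _ : I => H).
Local Notation P := (nil2_product Hs).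

Definition nil2_class (w : fp_word Hs) : P := quot_pi (nil2_kernel Hs) (fp_class w).
Definition nil2_in (i : I) (a : H) : P := nil2_class [:: @fp_letter I Hs i a].
Definition nil2_word (p : P) : fp_word Hs := repr (repr p).

Lemma nil2_wordK p : nil2_class (nil2_word p) = p.
Proof. by rewrite /nil2_class /nil2_word [fp_class _]reprK quot_reprK. Qed.

Lemma nil2_class_cat v w : nil2_class (v ++ w) = nil2_class v * nil2_class w.
Proof. by rewrite /nil2_class [RHS]quot_mulE [_ * _]fp_mulE. Qed.

Lemma nil2_class_cons l w : nil2_class (l :: w) = nil2_in (tag l) (tagged l) * nil2_class w.
Proof. by case: l => i a; rewrite -cat1s nil2_class_cat. Qed.

Lemma nil2_class_nil : nil2_class [::] = 1.
Proof. by []. Qed.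

Lemma nil2_inM i a b : nil2_in i (a * b) = nil2_in i a * nil2_in i b.
Proof.
rewrite /nil2_in -nil2_class_cat /nil2_class; congr quot_pi; apply/fp_classP/FpSym.
exact: (@FpMul I Hs [::] [::] i a b).
Qed.

Lemma nil2_in1 i : nil2_in i 1 = 1.
Proof. by apply: (mulgI (nil2_in i 1)); rewrite -nil2_inM !mulg1. Qed.

Lemma nil2_inV i a : nil2_in i a^-1 = (nil2_in i a)^-1.
Proof. by apply: (mulgI (nil2_in i a)); rewrite -nil2_inM !mulgV nil2_in1. Qed.

Lemma nil2_ind (Q : P -> Prop) :
  Q 1 -> (forall i a p, Q p -> Q (nil2_in i a * p)) -> forall p, Q p.
Proof.
move=> Q1 QM p; rewrite -(nil2_wordK p); elim: (nil2_word p) => [|l w IHw]; first exact: Q1.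
by rewrite nil2_class_cons; exact: QM.
Qed.

Lemma quot_piM (N : normalSubgroup (free_product Hs)) x y :
  quot_pi N (x * y) = quot_pi N x * quot_pi N y.
Proof. by rewrite [RHS]quot_mulE. Qed.

Lemma quot_piV (N : normalSubgroup (free_product Hs)) x :
  quot_pi N x^-1 = (quot_pi N x)^-1.
Proof. by rewrite [RHS]quot_invE. Qed.

Lemma central_comm_in j k a b : j != k -> central (comm (nil2_in j a) (nil2_in k b)).
Proof.
move=> jk p; apply/comm1P; elim/quot_piW: p => x.
transitivity (quot_pi (nil2_kernel Hs)
    (comm x (comm (fp_in (i := j) a) (fp_in (i := k) b))) : P).
  by rewrite /comm !(quot_piM, quot_piV).
apply/esym/quot_relP; rewrite invg1 mul1g => N; apply.
by exists x, j, k, a, b.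
Qed.

Section Lift.
Variables (T : groupType) (rho : I -> H -> T).
Hypothesis rhoM : forall i a b, rho i (a * b) = rho i a * rho i b.
Hypothesis rho_comm : forall j k a b, j != k -> central (comm (rho j a) (rho k b)).

Definition word_lift (w : fp_word Hs) : T :=
  foldr (fun l x => rho (tag l) (tagged l) * x) 1 w.

(** The map out of [P] given by homomorphisms [rho i : H -> T]: it exists as
soon as the commutators of the images of distinct copies are central in [T]
([nil2_lift_class]). *)
Definition nil2_lift (p : P) : T := word_lift (nil2_word p).

Lemma word_lift_cat v w : word_lift (v ++ w) = word_lift v * word_lift w.
Proof. by elim: v => [|l v IHv] /=; rewrite ?mul1g // IHv mulgA. Qed.

Lemma word_lift_eqv v w : fp_eqv v w -> word_lift v = word_lift w.
Proof.
elim=> {v w} [//|v w _ ->//|w1 w2 w3 _ -> _ ->//|v w i|v w i a b]; rewrite !word_lift_cat /=.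
- have -> : rho i 1 = 1 by apply: (mulgI (rho i 1)); rewrite -rhoM !mulg1.
  by rewrite mul1g.
- by rewrite rhoM !mulgA.
Qed.

Lemma nil2_lift_class w : nil2_lift (nil2_class w) = word_lift w.
Proof.
pose f (x : free_product Hs) := word_lift (repr x).
have fE v : f (fp_class v) = word_lift v by apply: word_lift_eqv; exact: fp_repr_class.
have fM x y : f (x * y) = f x * f y.
  elim/fp_classW: x => u; elim/fp_classW: y => v.
  by rewrite [fp_class u * _]fp_mulE !fE word_lift_cat.
have f1 : f 1 = 1 by apply: (mulgI (f 1)); rewrite -fM !mulg1.
have fV x : f x^-1 = (f x)^-1 by apply: (mulgI (f x)); rewrite -fM !mulgV.
have k1 : [set x | f x = 1] 1 by [].
have kM a b : [set a | f a = 1] a -> [set a | f a = 1] b -> [set a | f a = 1] (a * b).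
  by rewrite /= fM => -> ->; rewrite mulg1.
have kV a : [set a | f a = 1] a -> [set a | f a = 1] a^-1.
  by rewrite /= fV => ->; rewrite invg1.
have kJ a b : [set a | f a = 1] a -> [set a | f a = 1] (b * a * b^-1).
  by rewrite /= !fM fV => ->; rewrite mulg1 mulgV.
have : quot_pi (nil2_kernel Hs) (repr (nil2_class w)) = quot_pi _ (fp_class w).
  by rewrite quot_reprK.
move=> /quot_relP /(_ (NormalSubgroup k1 kM kV kJ)) /=.
rewrite fM fV fE => h; apply/esym/(mulgI (nil2_lift (nil2_class w))^-1).
rewrite mulVg; apply: h => _ [x [j [k [a [b [jk ->]]]]]] /=.
rewrite /comm !(fM, fV); apply/comm1P.
have fin i c : f (@fp_in I Hs i c) = rho i c by rewrite /fp_in fE /= mulg1.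
rewrite !fin.
exact: (rho_comm a b jk (f x)).
Qed.

Lemma nil2_liftM p q : nil2_lift (p * q) = nil2_lift p * nil2_lift q.
Proof. by rewrite -{1}(nil2_wordK p) -{1}(nil2_wordK q) -nil2_class_cat nil2_lift_class word_lift_cat. Qed.

Lemma nil2_lift1 : nil2_lift 1 = 1.
Proof. by rewrite -nil2_class_nil nil2_lift_class. Qed.

Lemma nil2_liftV p : nil2_lift p^-1 = (nil2_lift p)^-1.
Proof. by apply: (mulgI (nil2_lift p)); rewrite -nil2_liftM !mulgV nil2_lift1. Qed.

Lemma nil2_lift_in i a : nil2_lift (nil2_in i a) = rho i a.
Proof. by rewrite nil2_lift_class /= mulg1. Qed.
End Lift.

(** The retraction of [P] onto the copy of [H] at [y], with values in [H]. *)
Definition component (y : I) : P -> H := nil2_lift (fun i a => if i == y then a else 1).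

Fact component_rhoM y (i : I) (a b : H) : (if i == y then a * b else 1) =
  (if i == y then a else 1) * (if i == y then b else 1).
Proof. by case: ifP => //; rewrite mulg1. Qed.

Fact component_rho_comm y (j k : I) (a b : H) : j != k ->
  central (comm (if j == y then a else 1) (if k == y then b else 1)).
Proof.
move=> jk; suff -> : comm (if j == y then a else 1) (if k == y then b else 1) = 1.
  exact: central1.
apply/comm1P; case: eqP => [jy|_]; last exact/commute_sym/commute1.
by case: eqP => [ky|_]; [rewrite jy ky eqxx in jk|exact: commute1].
Qed.

Lemma componentM y p q : component y (p * q) = component y p * component y q.
Proof. exact: (nil2_liftM (@component_rhoM y) (@component_rho_comm y)). Qed.
Lemma componentV y p : component y p^-1 = (component y p)^-1.
Proof. exact: (nil2_liftV (@component_rhoM y) (@component_rho_comm y)). Qed.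
Lemma component1 y : component y 1 = 1.
Proof. exact: (nil2_lift1 (@component_rhoM y) (@component_rho_comm y)). Qed.
Lemma component_in y i a : component y (nil2_in i a) = if i == y then a else 1.
Proof. exact: (nil2_lift_in (@component_rhoM y) (@component_rho_comm y)). Qed.

(** The endomorphism of [P] that kills the copies of [H] outside [D]. *)
Definition retr (D : pred I) : P -> P := nil2_lift (fun i a => if D i then nil2_in i a else 1).

Fact retr_rhoM (D : pred I) (i : I) (a b : H) : (if D i then nil2_in i (a * b) else 1) =
  (if D i then nil2_in i a else 1) * (if D i then nil2_in i b else 1).
Proof. by case: ifP => //; rewrite ?nil2_inM // mulg1. Qed.

Fact retr_rho_comm (D : pred I) (j k : I) (a b : H) : j != k ->
  central (comm (if D j then nil2_in j a else 1) (if D k then nil2_in k b else 1)).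
Proof.
move=> jk; case: ifP => _; last first.
  rewrite (_ : comm _ _ = 1); first exact: central1.
  by apply/comm1P/commute_sym/commute1.
case: ifP => _; first exact: central_comm_in.
rewrite (_ : comm _ _ = 1); first exact: central1.
by apply/comm1P/commute1.
Qed.

Lemma retrM D p q : retr D (p * q) = retr D p * retr D q.
Proof. exact: (nil2_liftM (@retr_rhoM D) (@retr_rho_comm D)). Qed.
Lemma retrV D p : retr D p^-1 = (retr D p)^-1.
Proof. exact: (nil2_liftV (@retr_rhoM D) (@retr_rho_comm D)). Qed.
Lemma retr1 D : retr D 1 = 1.
Proof. exact: (nil2_lift1 (@retr_rhoM D) (@retr_rho_comm D)). Qed.
Lemma retr_in D i a : retr D (nil2_in i a) = if D i then nil2_in i a else 1.
Proof. exact: (nil2_lift_in (@retr_rhoM D) (@retr_rho_comm D)). Qed.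

Lemma retr_class (D : pred I) w : retr D (nil2_class w) = nil2_class [seq l <- w | D (tag l)].
Proof.
elim: w => [|l w IHw]; first exact: retr1.
by rewrite nil2_class_cons retrM retr_in IHw /=; case: ifP; rewrite ?mul1g // nil2_class_cons.
Qed.

(** Killing one after the other the copies outside [D] that occur in a word for
[p] amounts to keeping the copies in [D]. *)
Lemma retr_id (D : pred I) p :
  (forall y, ~~ D y -> retr (predC1 y) p = p) -> retr D p = p.
Proof.
move=> fixp.
have fix_seq (ys : seq I) : (forall y, y \in ys -> retr (predC1 y) p = p) ->
    nil2_class [seq l <- nil2_word p | tag l \notin ys] = p.
  elim: ys => [|y ys IHys] fixy; first by rewrite filter_predT nil2_wordK.
  have fix_ys : forall z, z \in ys -> retr (predC1 z) p = p.
    by move=> z zys; apply: fixy; rewrite inE zys orbT.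
  rewrite -[RHS](fixy y) ?mem_head // -[in RHS](IHys fix_ys).
  rewrite retr_class -filter_predI; congr nil2_class; apply: eq_filter => l /=.
  by rewrite inE negb_or.
rewrite -{1}(nil2_wordK p) retr_class -[RHS](fix_seq [seq y <- map tag (nil2_word p) | ~~ D y]).
  congr nil2_class; apply: eq_in_filter => l lw.
  by rewrite mem_filter (map_f (@tag I Hs)) // andbT negbK.
by move=> y; rewrite mem_filter => /andP[/fixp].
Qed.

(** The indices [y] such that [p] is moved by killing the copy at [y]; they
occur in every word for [p]. *)
Definition supp (p : P) : seq I :=
  undup [seq y <- map tag (nil2_word p) | retr (predC1 y) p != p].

Lemma supp_uniq p : uniq (supp p).
Proof. exact: undup_uniq. Qed.

Lemma mem_supp p y : (y \in supp p) = (retr (predC1 y) p != p).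
Proof.
rewrite mem_undup mem_filter; case: eqP => //= /eqP np; apply: contraNT np => yw.
rewrite -{1}(nil2_wordK p) retr_class -{2}(nil2_wordK p); apply/eqP; congr nil2_class.
apply/all_filterP/allP => l lw; apply: contraNneq yw => /= <-.
exact: map_f.
Qed.

Lemma retr_supp (D : pred I) p : {subset supp p <= D} -> retr D p = p.
Proof.
move=> sD; apply: retr_id => y nDy; apply/eqP; move: nDy; apply: contraNT.
by rewrite -mem_supp => /sD.
Qed.

Lemma retr_supp0 (D : pred I) p : (forall y, y \in supp p -> ~~ D y) -> retr D p = 1.
Proof.
move=> sD; have := retr_supp (D := predC D) (p := p) (fun y => sD y).
rewrite -{1}(nil2_wordK p) => <-; rewrite !retr_class -filter_predI.
rewrite (_ : [seq _ <- _ | _] = [::]) //; apply/eqP; rewrite -[_ == _]negbK -has_filter.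
by apply/hasPn => l _ /=; rewrite andbN.
Qed.

(** [a |-> [a_j, b_k]] is a homomorphism with central values, since commutators
of distinct copies are central. *)
Lemma derived_commute j k d b : j != k -> derived H d ->
  commute (nil2_in j d) (nil2_in k b).
Proof.
move=> jk Dd; apply/comm1P.
apply: (central_hom_derived (f := fun a => comm (nil2_in j a) (nil2_in k b))) Dd => [a a'|a].
  by rewrite nil2_inM commMl centralJ //; [exact: central_comm_in|exact: central_comm_in].
exact: central_comm_in.
Qed.

Definition derword (w : fp_word Hs) : Prop :=
  forall l, l \in w -> derived H (tagged l).

(** The products of elements of the derived subgroups of the copies of [H]. *)
Definition derp_set (p : P) : Prop := exists2 w, derword w & p = nil2_class w.

Lemma derp_ind (Q : P -> Prop) : Q 1 ->
  (forall i d p, derived H d -> derp_set p -> Q p -> Q (nil2_in i d * p)) ->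
  forall p, derp_set p -> Q p.
Proof.
move=> Q1 QM _ [w Dw ->]; elim: w Dw => [|l w IHw] Dw; first exact: Q1.
have Dw' : derword w by move=> l' l'w; apply: Dw; rewrite inE l'w orbT.
by rewrite nil2_class_cons; apply: QM (IHw Dw'); [apply: Dw; rewrite mem_head|exists w].
Qed.

Fact derp1 : derp_set 1.
Proof. by exists [::]. Qed.

Fact derpM p q : derp_set p -> derp_set q -> derp_set (p * q).
Proof.
move=> [v Dv ->] [w Dw ->]; exists (v ++ w); last by rewrite nil2_class_cat.
by move=> l; rewrite mem_cat => /orP[/Dv|/Dw].
Qed.

Fact derp_in i d : derived H d -> derp_set (nil2_in i d).
Proof. by move=> Dd; exists [:: @fp_letter I Hs i d] => // l; rewrite inE => /eqP ->. Qed.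

Fact derpV p : derp_set p -> derp_set p^-1.
Proof.
apply: (derp_ind (Q := fun p => derp_set p^-1)) => [|i d q Dd _ IH].
  by rewrite invg1; exact: derp1.
rewrite invgM -nil2_inV; apply: derpM IH (derp_in _ _); exact: nsgV.
Qed.

(** Conjugation by a letter [a_k] acts on each factor [d_i]: trivially if [i !=
k], and by [d |-> a d a^-1] if [i = k]. *)
Fact derpJ p q : derp_set p -> derp_set (q * p * q^-1).
Proof.
elim/nil2_ind: q p => [|k a q IHq] p Dp; first by rewrite invg1 mulg1 mul1g.
have -> : nil2_in k a * q * p * (nil2_in k a * q)^-1 = nil2_in k a * (q * p * q^-1 * (nil2_in k a)^-1).
  by rewrite invgM !mulgA.
move: (IHq _ Dp).
move: {p Dp}(q * p * q^-1).
apply: (derp_ind (Q := fun r => derp_set (nil2_in k a * (r * (nil2_in k a)^-1)))) => [|i d r Dd _ IH].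
  by rewrite mul1g mulgV; exact: derp1.
have -> : nil2_in k a * (nil2_in i d * r * (nil2_in k a)^-1) =
    (nil2_in k a * nil2_in i d * nil2_in k a^-1) * (nil2_in k a * (r * (nil2_in k a)^-1)).
  by rewrite !nil2_inV !mulgA mulgVK.
apply: derpM IH; case: (eqVneq i k) => [->|ik].
  by rewrite -!nil2_inM; apply: derp_in; exact: nsgJ.
by rewrite -(derived_commute a ik Dd) nil2_inV mulgK; exact: derp_in.
Qed.

Definition derp : normalSubgroup P := NormalSubgroup derp1 derpM derpV derpJ.

Lemma retr1_component y p : retr (pred1 y) p = nil2_in y (component y p).
Proof.
elim/nil2_ind: p => [|i a p IHp]; first by rewrite retr1 component1 nil2_in1.
rewrite retrM retr_in IHp componentM component_in nil2_inM /=.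
by case: eqP => [->//|_]; rewrite nil2_in1.
Qed.

(** Elements of the derived subgroups of distinct copies commute, so those at
[y] can be collected on the left. *)
Lemma retr_split y p : derp p -> p = retr (pred1 y) p * retr (predC1 y) p.
Proof.
apply: (derp_ind (Q := fun p => p = retr (pred1 y) p * retr (predC1 y) p)) => [|i d q Dd _ IH].
  by rewrite !retr1 mulg1.
rewrite !retrM !retr_in /=; case: (eqVneq i y) => [->|iy] /=.
  by rewrite mul1g -mulgA -IH.
have cm : commute (nil2_in i d) (retr (pred1 y) q).
  by rewrite retr1_component; exact: derived_commute.
by rewrite mul1g {1}IH mulgA cm -mulgA.
Qed.

(** By [retr_split] the copy at [y] contributes only the coordinate at [y],
which is trivial; hence killing any copy, and so all of them, fixes [p]. *)
Lemma derp_component p : derp p -> (forall y, component y p = 1) -> p = 1.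
Proof.
move=> Dp p1; have fixp y : retr (predC1 y) p = p.
  by rewrite [RHS](retr_split y Dp) retr1_component p1 nil2_in1 mul1g.
rewrite -[LHS](retr_id (D := pred0)) // -(nil2_wordK p) retr_class.
by rewrite (eq_filter (a2 := pred0)) ?filter_pred0.
Qed.

Definition nilquot : groupType := quot_group derp.
Definition nilproj : P -> nilquot := quot_pi derp.

Lemma nilprojM p q : nilproj (p * q) = nilproj p * nilproj q.
Proof. by rewrite /nilproj [RHS]quot_mulE. Qed.

Lemma nilprojV p : nilproj p^-1 = (nilproj p)^-1.
Proof. by rewrite /nilproj [RHS]quot_invE. Qed.

(** [P] embeds in the product of the copies of [H] and [P / derp]. *)
Lemma nilproj_eq p q : nilproj p = nilproj q -> (forall y, component y p = component y q) -> p = q.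
Proof.
move=> /quot_relP Dpq pq; apply: (mulgI p^-1); rewrite mulVg; apply/esym/derp_component => //.
by move=> y; rewrite componentM componentV pq mulVg.
Qed.

Lemma nilquot_ind (Q : nilquot -> Prop) :
  Q 1 -> (forall i a p, Q p -> Q (nilproj (nil2_in i a) * p)) -> forall p, Q p.
Proof.
move=> Q1 QM; elim/quot_piW => p; rewrite -[quot_pi _ _]/(nilproj p).
by elim/nil2_ind: p => [//|i a p]; rewrite nilprojM; exact: QM.
Qed.

(** Commutators of generators are central: for distinct copies by the relations,
and within one copy because they are killed. The identities [commMl] and
[commMr] extend this to all elements. *)
Lemma nilquot_class2 : class2 nilquot.
Proof.
have wr_base i a j b : central (comm (nilproj (nil2_in i a)) (nilproj (nil2_in j b))).
  rewrite /comm -!(nilprojM, nilprojV) -/(comm (nil2_in i a) (nil2_in j b)).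
  have [->|ij] := eqVneq i j.
    rewrite (_ : nilproj _ = 1); first exact: central1.
    apply/esym/quot_relP; rewrite invg1 mul1g /comm -!nil2_inV -!nil2_inM.
    exact/derp_in/derived_comm.
  elim/quot_piW => p; rewrite -[quot_pi _ _]/(nilproj p) /commute -!nilprojM.
  by rewrite (central_comm_in a b ij).
have gen i a y : central (comm (nilproj (nil2_in i a)) y).
  elim/nilquot_ind: y => [|j b y IHy].
    by rewrite (_ : comm _ _ = 1); [exact: central1|apply/comm1P/commute1].
  by rewrite commMr (centralJ _ IHy); exact: centralM.
elim/nilquot_ind => [|i a x IHx] y.
  by rewrite (_ : comm _ _ = 1); [exact: central1|apply/comm1P/commute_sym/commute1].
by rewrite commMl (centralJ _ (IHx y)); exact: centralM.
Qed.

End Nil2.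

(** * The shift action *)

Section Shift.
Local Open Scope group_scope.
Variables (G H : groupType).
Local Notation Hs := (fun _ : G => H).
Local Notation P := (nil2_product Hs).

Lemma shift_class g (w : fp_word Hs) : nil2_shift g (nil2_class w) = nil2_class (shift_word g w).
Proof. by rewrite /nil2_class nil2_shiftE fp_shiftE. Qed.

Lemma shift_retr g (D : pred G) (p : P) :
  nil2_shift g (retr D p) = retr (fun y => D (g^-1 * y)) (nil2_shift g p).
Proof.
rewrite -(nil2_wordK p) retr_class !shift_class retr_class; congr nil2_class.
by rewrite /shift_word filter_map; congr map; apply: eq_filter => l /=; rewrite mulKg.
Qed.

Lemma shiftK g : cancel (nil2_shift g) (@nil2_shift H G g^-1).
Proof. by move=> p; rewrite -nil2_shiftA mulVg nil2_shift1. Qed.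

(** The shift by [g] carries the retraction killing [y] to the retraction
killing [g * y]. *)
Lemma supp_shift g (p : P) :
  perm_eq (supp (nil2_shift g p)) [seq g * y | y <- supp p].
Proof.
apply: uniq_perm; rewrite ?supp_uniq //.
  by rewrite map_inj_uniq ?supp_uniq //; exact: mulgI.
move=> y; rewrite -(mulVKg g y) (mem_map (@mulgI _ g)) !mem_supp.
rewrite -[in LHS](can_eq (shiftK g^-1)) shiftK shift_retr.
rewrite shiftK.
congr (_ != _).
rewrite -{1}(nil2_wordK p) -{2}(nil2_wordK p) !retr_class; congr nil2_class; apply: eq_filter => l.
by rewrite /= invgK (can_eq (mulKg g)).
Qed.
End Shift.

(** * Growth of groups of nilpotency class two *)

Section Growth.
Local Open Scope group_scope.
Variable T : groupType.

Definition seqmul (A B : seq T) : seq T := [seq x * y | x <- A, y <- B].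

Lemma mem_seqmul A B x y : x \in A -> y \in B -> x * y \in seqmul A B.
Proof. by move=> xA yB; apply: allpairs_f. Qed.

Lemma size_seqmul A B : size (seqmul A B) = (size A * size B)%N.
Proof. exact: size_allpairs. Qed.

(** Products of at most [N] commuting elements only depend on the
multiplicities, each at most [N]. *)
Lemma central_growth (zs : seq T) N : (forall z, z \in zs -> central z) ->
  exists2 L : seq T, size L = (N.+1 ^ size zs)%N &
    forall w : seq T, {subset w <= zs} -> (size w <= N)%N -> \prod_(x <- w) x \in L.
Proof.
elim: zs => [|z zs IHzs] zc.
  exists [:: 1] => // w w0 _; case: w w0 => [|x w] w0; first by rewrite big_nil mem_head.
  by have := w0 x; rewrite mem_head => /(_ isT).
have [|L sL LP] := IHzs; first by move=> y yzs; apply: zc; rewrite inE yzs orbT.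
exists (seqmul [seq z ^+ k | k <- iota 0 N.+1] L).
  by rewrite size_seqmul size_map size_iota sL expnS.
move=> w wzs wN.
have -> : \prod_(x <- w) x = z ^+ count_mem z w * \prod_(x <- w | x != z) x.
  elim: w {wzs wN} => [|y w IHw]; first by rewrite !big_nil mulg1.
  rewrite !big_cons /= IHw; case: (eqVneq y z) => [->|yz] /=.
    by rewrite expgS mulgA.
  by rewrite !mulgA; congr (_ * _); apply/commuteX/zc; rewrite mem_head.
apply: mem_seqmul.
  apply: map_f; rewrite mem_iota /= add0n ltnS.
  exact: leq_trans (count_size _ _) wN.
rewrite -big_filter; apply: LP => [x|].
  by rewrite mem_filter => /andP[xz /wzs]; rewrite inE (negPf xz).
by rewrite size_filter; exact: leq_trans (count_size _ _) wN.
Qed.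

Hypothesis T2 : class2 T.

(** Moving an occurrence of [g] to the right past the word [v] costs the central
factor [\prod_(x <- v) comm g x]; this is at most [size w] commutators for each
of at most [size w] occurrences. *)
Lemma collect (g : T) (w : seq T) : exists cs : seq T,
  [/\ {subset cs <= [seq comm g x | x <- w]}, (size cs <= size w * size w)%N &
  \prod_(x <- w) x =
  \prod_(x <- w | x != g) x * g ^+ count_mem g w * \prod_(c <- cs) c].
Proof.
have commR v : comm g (\prod_(x <- v) x) = \prod_(c <- [seq comm g x | x <- v]) c.
  elim: v => [|x v IHv]; first by rewrite !big_nil; apply/comm1P/commute1.
  by rewrite big_cons commMr centralJ //= big_cons IHv.
elim: w => [|y w [cs [cs_sub cs_size E]]].
  by exists [::]; rewrite !big_nil !mulg1.
case: (eqVneq y g) => [->|yg]; last first.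
  exists cs; split => [c /cs_sub|| /=]; first by rewrite inE orbC => ->.
    by apply: leq_trans cs_size _; rewrite /= leq_mul.
  by rewrite !big_cons yg (negPf yg) E !mulgA.
set v := [seq x <- w | x != g].
have commE : g * \prod_(x <- v) x =
    \prod_(x <- v) x * g * \prod_(c <- [seq comm g x | x <- v]) c.
  by rewrite -commR [RHS]T2 /comm !mulgA !mulgVK.
exists ([seq comm g x | x <- v] ++ cs); split.
- move=> c; rewrite mem_cat => /orP[/mapP[x]|/cs_sub]; last by rewrite inE orbC => ->.
  by rewrite mem_filter => /andP[_ xw] ->; rewrite inE map_f ?orbT.
- rewrite size_cat size_map /= mulSn mulnS.
  apply: leq_add; last by apply: leq_trans cs_size _; rewrite leq_addl.
  by rewrite leqW // size_filter count_size.
- rewrite !big_cons /= eqxx /= E -big_filter -/v !mulgA commE big_cat /= expgS !mulgA.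
  congr (_ * _); rewrite -!mulgA; congr (_ * (_ * _)).
  have cc : central (\prod_(c <- [seq comm g x | x <- v]) c) by rewrite -commR.
  by rewrite -cc.
Qed.

(** With [collect], a word of length at most [n] in [g :: gs] is a word of
length at most [n] in [gs], times a power of [g] of exponent at most [n], times
a product of at most [n ^ 2] central elements among the [comm g x]. *)
Lemma class2_growth (gs : seq T) : exists D, forall n, exists2 L : seq T,
  (size L <= n.+1 ^ D)%N &
  forall w : seq T, {subset w <= gs} -> (size w <= n)%N -> \prod_(x <- w) x \in L.
Proof.
elim: gs => [|g gs [D IHD]].
  exists 0%N => n; exists [:: 1] => // w w0 _.
  case: w w0 => [|x w] w0; first by rewrite big_nil mem_head.
  by have := w0 x; rewrite mem_head => /(_ isT).
pose zs := [seq comm g x | x <- g :: gs].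
exists (D + (1 + 2 * size zs))%N => n.
have [L sL LP] := IHD n.
have [|Z sZ ZP] := @central_growth zs (n * n)%N.
  by move=> _ /mapP[x _ ->]; exact: T2.
exists (seqmul (seqmul L [seq g ^+ k | k <- iota 0 n.+1]) Z).
  rewrite !size_seqmul size_map size_iota sZ !expnD expn1 -mulnA.
  apply: leq_mul => //; apply: leq_mul => //; rewrite expnM leq_exp2r //.
  by rewrite -mulnn mulSn mulnS addSn ltnS addnA leq_addl.
move=> w wgs wn; have [cs [cs_sub cs_size ->]] := collect g w.
have cnt a : (count a w <= n)%N by exact: leq_trans (count_size _ _) wn.
apply: mem_seqmul; first apply: mem_seqmul.
- rewrite -big_filter; apply: LP; last by rewrite size_filter.
  by move=> x; rewrite mem_filter => /andP[xg /wgs]; rewrite inE (negPf xg).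
- by apply: map_f; rewrite mem_iota /= add0n ltnS.
- apply: ZP; last by apply: leq_trans cs_size _; exact: leq_mul.
  by move=> c /cs_sub /mapP[x /wgs xgs ->]; exact: map_f.
Qed.

Fixpoint word_ball (gs : seq T) n : seq T :=
  if n is n'.+1 then undup (seqmul (1 :: gs) (word_ball gs n')) else [:: 1].

Lemma word_ball_uniq gs n : uniq (word_ball gs n).
Proof. by case: n => // n; exact: undup_uniq. Qed.

Lemma word_ballS gs n g x : g \in 1 :: gs -> x \in word_ball gs n -> g * x \in word_ball gs n.+1.
Proof. by move=> gg xb; rewrite /= mem_undup mem_seqmul. Qed.

Lemma word_ball_sub gs n : {subset word_ball gs n <= word_ball gs n.+1}.
Proof. by move=> x xb; rewrite -(mul1g x); apply: word_ballS => //; exact: mem_head. Qed.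

Lemma word_ball_word gs n x : x \in word_ball gs n ->
  exists w, [/\ {subset w <= 1 :: gs}, size w = n & x = \prod_(y <- w) y].
Proof.
elim: n x => [|n IHn] x /=; first by rewrite inE => /eqP ->; exists [::]; rewrite big_nil.
rewrite mem_undup => /allpairsP[[g y] /= [gg /IHn[w [w_sub sw ->]] ->]].
exists (g :: w); split=> [z||]; last by rewrite big_cons.
  by rewrite inE => /orP[/eqP ->|/w_sub].
by rewrite /= sw.
Qed.

Lemma size_word_ball_gt0 gs n : (0 < size (word_ball gs n))%N.
Proof.
elim: n => // n IHn; apply: leq_trans IHn _.
by apply: uniq_leq_size (word_ball_uniq _ _) _; exact: word_ball_sub.
Qed.

Lemma word_ball_growth gs : exists D, forall n, (size (word_ball gs n) <= n.+1 ^ D)%N.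
Proof.
have [D DP] := class2_growth (1 :: gs); exists D => n; have [L sL LP] := DP n.
apply: leq_trans sL; apply: uniq_leq_size (word_ball_uniq _ _) _.
by move=> _ /word_ball_word[w [w_sub sw ->]]; apply: LP; rewrite ?sw.
Qed.

End Growth.

(** * Positive definite functions from Folner sets *)

Section Folner.
Variable R : realType.

Lemma bernoulli_ineq (e : R) n : 0 <= e -> 1 + n%:R * e <= (1 + e) ^+ n.
Proof.
move=> e0; elim: n => [|n IHn]; first by rewrite mul0r addr0.
rewrite exprS; apply: le_trans (_ : (1 + e) * (1 + n%:R * e) <= _).
  have : 0 <= n%:R * (e * e) by rewrite !mulr_ge0.
  by rewrite -natr1 => h; lra.
by apply: ler_wpM2l => //; rewrite addr_ge0.
Qed.

(** At [n = (D + 1) m] Bernoulli's inequality gives [(1 + e) ^ n >= (1 + m e) ^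
(D + 1)], of larger degree in [m] than [(n + 1) ^ D]. *)
Lemma exp_beats_poly (e : R) D : 0 < e <= 1 ->
  exists n, n.+1%:R ^+ D < (1 + e) ^+ n.
Proof.
move=> /andP[e0 e1]; apply: contrapT => no.
have le n : (1 + e) ^+ n <= n.+1%:R ^+ D.
  by rewrite leNgt; apply/negP => h; apply: no; exists n.
pose C : R := (D.+1%:R / e) ^+ D.
have bnd m : m%:R * e <= C.
  have h1 : (1 + m%:R * e) ^+ D.+1 <= (D.+1 * m).+1%:R ^+ D.
    apply: le_trans (le _); rewrite mulnC exprM lerXn2r ?nnegrE //.
    - by rewrite addr_ge0 // mulr_ge0 // ltW.
    - by rewrite exprn_ge0 // addr_ge0 // ltW.
    - by apply: bernoulli_ineq; exact: ltW.
  have h2 : ((D.+1 * m).+1%:R : R) ^+ D <= (D.+1%:R * m.+1%:R) ^+ D.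
    by rewrite lerXn2r ?nnegrE -?natrM // ler_nat mulnS addSn ltnS leq_addl.
  have h3 : (e * m.+1%:R) ^+ D <= (1 + m%:R * e) ^+ D.
    rewrite lerXn2r ?nnegrE //.
    - by rewrite mulr_ge0 // ltW.
    - by rewrite addr_ge0 // mulr_ge0 // ltW.
    - by rewrite -natr1 mulrDr mulr1 addrC (mulrC e) lerD2r.
  have m0 : 0 < (e * m.+1%:R) ^+ D :> R by rewrite exprn_gt0 // mulr_gt0 // ltr0n.
  apply: le_trans (_ : 1 + m%:R * e <= C); first by rewrite lerDr.
  rewrite -(ler_pM2r m0); apply: le_trans (_ : (1 + m%:R * e) ^+ D.+1 <= _).
    by rewrite exprS ler_wpM2l // addr_ge0 // mulr_ge0 // ltW.
  apply: le_trans h1 _; apply: le_trans h2 _; rewrite /C -exprMn.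
  rewrite (_ : D.+1%:R / e * (e * m.+1%:R) = D.+1%:R * m.+1%:R) //.
  by field; rewrite gt_eqF.
have := bnd (Num.truncn (C / e)).+1; apply/negP; rewrite -ltNge.
by rewrite -ltr_pdivrMr // truncnS_gt.
Qed.

(** Otherwise [a n >= (1 + e) ^ n] for all [n]. *)
Lemma slow_growth (a : nat -> nat) D (e : R) : 0 < e <= 1 ->
  (0 < a 0)%N -> (forall n, (a n <= n.+1 ^ D)%N) ->
  exists n, (a n.+1)%:R <= (1 + e) * (a n)%:R.
Proof.
move=> e01 a0 aD; have [n nP] := exp_beats_poly D e01.
have e0 : 0 <= e by move: e01 => /andP[/ltW].
apply: contrapT => no.
have grow k : (1 + e) ^+ k <= (a k)%:R.
  elim: k => [|k IHk]; first by rewrite expr0 ler1n.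
  rewrite leNgt; apply/negP => h; apply: no; exists k.
  apply/ltW/(lt_le_trans h); rewrite exprS ler_wpM2l //.
  by rewrite addr_ge0.
have := le_lt_trans (grow n) (_ : (a n)%:R < (1 + e) ^+ n).
rewrite ltxx => h; suff : false by []; apply: h.
by apply: le_lt_trans nP; rewrite -natrX ler_nat.
Qed.

(** The fraction of [B] which translation by [g] keeps in [B], that is, the
matrix coefficient of the regular representation at the normalized indicator of
[B]. *)
Definition overlap (T : groupType) (B : seq T) (g : T) : R :=
  (size B)%:R^-1 * \sum_(b <- B) \sum_(c <- B) ((g * b)%g == c)%:R.

Lemma sum_mem (T : eqType) (B : seq T) x : uniq B ->
  \sum_(c <- B) (x == c)%:R = (x \in B)%:R :> R.
Proof.
elim: B => [|c B IHB]; first by rewrite big_nil.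
rewrite big_cons inE /= => /andP[cB /IHB ->].
by case: eqP => [->|_] /=; rewrite ?(negPf cB) ?addr0 ?add0r.
Qed.

Lemma overlapE (T : groupType) (B : seq T) g : uniq B ->
  overlap B g = (size B)%:R^-1 * (count (fun b => (g * b)%g \in B) B)%:R.
Proof.
move=> uB; rewrite /overlap -sum1_count natr_sum [in RHS]big_mkcond /=.
congr (_ * _); apply: eq_bigr => b _; rewrite sum_mem //.
by case: (_ \in _).
Qed.

Lemma overlap_npd (T : groupType) (B : seq T) : uniq B -> (0 < size B)%N ->
  npd (overlap B).
Proof.
move=> uB B0; split.
  rewrite overlapE // (_ : count _ _ = size B) ?mulVf ?pnatr_eq0 -?lt0n //.
  by apply/eqP; rewrite -all_count; apply/allP => b bB; rewrite mul1g.
have := psdM (psd_const T (_ : 0 <= (size B)%:R^-1))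
  (psd_comb (fun u => [seq (1, (u * b)%g) | b <- B]) (psd_eqop R T)).
rewrite invr_ge0 ler0n => /(_ isT); apply: eq_psd => u v.
rewrite /overlap /qform big_map; congr (_ * _); apply: eq_bigr => b _.
rewrite big_map; apply: eq_bigr => c _; rewrite /= !mul1r.
by rewrite -mulgA (can2_eq (mulVKg v) (mulKg v)).
Qed.

Lemma overlap_fin (T : groupType) (B : seq T) (e : R) : uniq B -> 0 < e ->
  finite_set [set g | e <= `|overlap B g|].
Proof.
move=> uB e0; apply: (@sub_finite_set _ _ [set` [seq (c * b^-1)%g | c <- B, b <- B]]).
  move=> g /= eg; have : overlap B g != 0.
    by apply: contraTneq eg => ->; rewrite normr0 -ltNge.
  rewrite overlapE //; apply: contraNT => gB; rewrite mulf_eq0 pnatr_eq0.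
  apply/orP; right; rewrite -leqn0 leqNgt -has_count; apply: contra gB.
  move=> /hasP[b bB gbB]; rewrite -(mulgK b g).
  by apply/allpairsP; exists ((g * b)%g, b).
exact: finite_seq.
Qed.

(** [B] and the part of [g B] outside [B] are disjoint in [C]. *)
Lemma overlap_near (T : groupType) (B C : seq T) g (e : R) : uniq B ->
  (0 < size B)%N -> uniq C -> {subset B <= C} -> (forall b, b \in B -> (g * b)%g \in C) ->
  (size C)%:R <= (1 + e) * (size B)%:R -> 1 - e <= overlap B g.
Proof.
move=> uB B0 uC BC gBC CB.
have BP : 0 < (size B)%:R :> R by rewrite ltr0n.
rewrite overlapE // [leRHS]mulrC ler_pdivlMr //.
set k := count _ _.
have : (size B + size B <= size C + k)%N.
  rewrite -{2}(count_predC (fun b => (g * b)%g \in B) B) -/k addnA addnAC leq_add2r.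
  rewrite -size_filter -(size_map (fun b => (g * b)%g)) -size_cat.
  apply: uniq_leq_size.
    rewrite cat_uniq uB /= map_inj_uniq ?filter_uniq //; last exact: mulgI.
    rewrite andbT; apply/hasPn => x /mapP[b]; rewrite mem_filter /= => /andP[h _] ->.
    exact: h.
  move=> x; rewrite mem_cat => /orP[/BC //|/mapP[b]].
  by rewrite mem_filter => /andP[_ /gBC h] ->.
rewrite -(ler_nat R) !natrD.
by move: CB; clear; lra.
Qed.

Lemma class2_haagerup (T : groupType) : class2 T -> real_haagerup R T.
Proof.
move=> T2 Q e e0.
have d01 : 0 < Num.min e 1 <= 1 by rewrite lt_min e0 ltr01 ge_min lexx orbT.
have [D DP] := word_ball_growth T2 Q.
have [n nP] := slow_growth d01 (size_word_ball_gt0 Q 0) DP.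
exists (overlap (word_ball Q n)); split.
- by apply: overlap_npd; [exact: word_ball_uniq|exact: size_word_ball_gt0].
- by move=> d d0; apply: overlap_fin; [exact: word_ball_uniq|].
- move=> g gQ; apply: le_trans (overlap_near (C := word_ball Q n.+1) _ _ _ _ _ nP).
  + by rewrite lerD2l lerN2 ge_min lexx.
  + exact: word_ball_uniq.
  + exact: size_word_ball_gt0.
  + exact: word_ball_uniq.
  + exact: word_ball_sub.
  + by move=> b; apply: word_ballS; rewrite inE gQ orbT.
Qed.
End Folner.

(** * Positive definite functions on the wreath product *)

Section Assembly.
Variables (R : realType) (H G : groupType).
Local Notation Hs := (fun _ : G => H).
Local Notation P := (nil2_product Hs).
Local Notation W := (nil2_wreath H G).

Definition wr_base (u : W) : P := sd_fst (u : semidirect (nil2_shift_action H G)).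
Definition wr_top (u : W) : G := sd_snd (u : semidirect (nil2_shift_action H G)).
Definition pair_wr (p : P) (x : G) : W := Semidirect (nil2_shift_action H G) p x.

Lemma wr_baseVM (u v : W) :
  wr_base (v^-1 * u)%g = nil2_shift (wr_top v)^-1%g ((wr_base v)^-1 * wr_base u)%g.
Proof. by rewrite nil2_shiftM. Qed.

Lemma wr_topVM (u v : W) : wr_top (v^-1 * u)%g = ((wr_top v)^-1 * wr_top u)%g.
Proof. by []. Qed.

Lemma wr_base1 : wr_base 1%g = 1%g. Proof. by []. Qed.
Lemma wr_top1 : wr_top 1%g = 1%g. Proof. by []. Qed.

Lemma wreath_eq (u v : W) : wr_base u = wr_base v -> wr_top u = wr_top v -> u = v.
Proof. by case: u v => [p x] [q y]; rewrite /wr_base /wr_top /= => -> ->. Qed.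

(** Definitions by bookkeeping over a finite support agree with a manifestly
positive semidefinite kernel on any finite set of points. *)
Lemma psd_local (X : eqType) (K : X -> X -> R) :
  (forall s : seq X, exists2 L : X -> X -> R, psd L &
     forall x y, x \in s -> y \in s -> K x y = L x y) -> psd K.
Proof.
move=> loc; split=> [x y|s].
  have [L pL E] := loc [:: x; y].
  by rewrite !E ?inE ?eqxx ?orbT // (proj1 pL).
have [L pL E] := loc [seq a.2 | a <- s].
have -> : qform K s s = qform L s s; last exact: (proj2 pL).
rewrite /qform [LHS]big_seq [RHS]big_seq; apply: eq_bigr => a sa.
rewrite [LHS]big_seq [RHS]big_seq; apply: eq_bigr => b sb.
by rewrite E // map_f.
Qed.

Section Wave.
Variables (phi : G -> R) (m : nat).
Hypothesis phi_npd : npd phi.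

Definition fwave (u : W) : R := wave phi m (supp (wr_base u)) (wr_top u) 1%g.

Lemma supp1 : supp (1%g : P) = [::].
Proof.
case E : (supp _) => [//|y s]; have : y \in supp (1%g : P) by rewrite E mem_head.
by rewrite mem_supp retr1 eqxx.
Qed.

(** The quantity whose equality at [u] and [v] expresses that [y] is not in the
support of [v^-1 u] ([sepP]). *)
Definition sep (y : G) (u : W) : P := (wr_base u * (retr (predC1 y) (wr_base u))^-1)%g.

Lemma sepP y (u v : W) :
  (sep y u == sep y v) = (y \notin supp ((wr_base v)^-1 * wr_base u)%g).
Proof.
rewrite mem_supp negbK retrM retrV /sep.
move: (wr_base u) (wr_base v) (retr _ _) (retr _ _) => p q q' p'.
apply/eqP/eqP => h; first by rewrite -(mulgVK p' p) h -mulgA mulKg.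
by rewrite -{1}(mulVKg q p) -h mulgA mulgK.
Qed.

Lemma fwaveVM (u v : W) : fwave (v^-1 * u)%g =
  wave phi m (supp ((wr_base v)^-1 * wr_base u)%g) (wr_top u) (wr_top v).
Proof.
rewrite /fwave wr_baseVM wr_topVM.
rewrite (wave_perm phi_npd m _ _ (supp_shift (wr_top v)^-1%g ((wr_base v)^-1 * wr_base u)%g)).
by rewrite -(mulVg (wr_top v)) wave_map.
Qed.

(** On finitely many points the supports of all quotients lie in one list [ys],
and damping the letters of [ys] that separate two points is damping the support
of their quotient. *)
Lemma fwave_npd : npd fwave.
Proof.
split; first by rewrite /fwave wr_base1 wr_top1 supp1 wave_nil1.
apply: psd_local => s.
pose ys := undup (flatten [seq supp ((wr_base v)^-1 * wr_base u)%g | u <- s, v <- s]).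
pose N := fun p q : W * seq G =>
  damps [seq y <- ys | sep y p.1 != sep y q.1] (phase phi) p.2 q.2.
have pN : psd N := psd_damps_sep sep ys (psd_phase phi_npd) (shiftinv_phase phi_npd).
exists (fun u v => m.+1%:R^-1 * \sum_(0 <= j < m.+1) \sum_(0 <= i < m.+1)
     N (u, nseq j (wr_top u)) (v, nseq i (wr_top v))).
  exact: wave_psd_aux.
(* By [sepP] the letters of [ys] that separate [u] and [v] are exactly the
   support of [v^-1 u] at the base, listed in another order. *)
move=> u v us vs; rewrite fwaveVM /N /= -/(wave phi m _ (wr_top u) (wr_top v)).
apply: wave_perm => //; apply: uniq_perm; rewrite ?supp_uniq ?filter_uniq ?undup_uniq //.
move=> y; rewrite mem_filter sepP negbK.
apply/idP/andP => [ysupp|[]//]; split=> //; rewrite mem_undup; apply/flattenP.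
by exists (supp ((wr_base v)^-1 * wr_base u)%g) => //; apply: allpairs_f.
Qed.

Lemma fwave_top x : 1 - 2 * m%:R ^+ 2 * (1 - phi x) <= fwave (pair_wr 1%g x).
Proof.
by have := wave_nil phi_npd m x 1%g; rewrite invg1 mul1g /fwave /wr_base /wr_top /= supp1.
Qed.

Lemma fwave_in y a :
  1 - (m.+1%:R^-1 + (1 - phi y)) <= fwave (pair_wr (nil2_in y a) 1%g).
Proof.
rewrite /fwave /wr_base /wr_top /=.
have : {subset supp (nil2_in y a : P) <= [:: y]}.
  move=> z; rewrite mem_supp retr_in /= inE eq_sym.
  by case: (eqVneq z y) => //= _; rewrite eqxx.
have := supp_uniq (nil2_in y a : P).
case: (supp _) => [_ _|z [|z' s] u sub].
- rewrite wave_nil1 // lerBlDr lerDl addr_ge0 ?invr_ge0 //.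
  by rewrite subr_ge0; exact: npd_le1.
- have := sub z (mem_head _ _); rewrite inE => /eqP ->.
  by have := wave1_ge phi_npd m 1%g y; rewrite invg1 mul1g.
- have := sub z (mem_head _ _); have := sub z'.
  rewrite !inE eqxx orbT => /(_ isT) /eqP E /eqP E'.
  by move: u; rewrite E E' /= inE eqxx.
Qed.

(** An element is a product of letters and an element of [G], and [npd_mul]
loses at most a factor [4] for each letter. *)
Lemma fwave_near (u : W) (d : R) : 0 <= d ->
  (forall y, y \in map tag (nil2_word (wr_base u)) -> m.+1%:R^-1 + (1 - phi y) <= d) ->
  2 * m%:R ^+ 2 * (1 - phi (wr_top u)) <= d ->
  1 - fwave u <= 4 ^+ size (nil2_word (wr_base u)) * d.
Proof.
move=> d0 small_base small_top.
have -> : u = pair_wr (nil2_class (nil2_word (wr_base u))) (wr_top u).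
  by apply: wreath_eq; rewrite /wr_base /wr_top /= ?nil2_wordK.
have -> : nil2_word (wr_base (pair_wr (nil2_class (nil2_word (wr_base u))) (wr_top u))) = nil2_word (wr_base u).
  by rewrite {1}/wr_base /= nil2_wordK.
elim: (nil2_word (wr_base u)) small_base => [|l w IHw] small_base.
  rewrite expr0 mul1r lerBlDr -lerBlDl; apply: le_trans (fwave_top _).
  by rewrite lerD2l lerN2.
have -> : pair_wr (nil2_class (l :: w)) (wr_top u) =
    (pair_wr (nil2_in (tag l) (tagged l)) 1 * pair_wr (nil2_class w) (wr_top u))%g.
  apply: wreath_eq; rewrite /wr_base /wr_top /=; last by rewrite mul1g.
  by rewrite nil2_shift1 nil2_class_cons.
apply: le_trans (npd_mul _ _ fwave_npd) _.
have h1 : 1 - fwave (pair_wr (nil2_in (tag l) (tagged l)) 1%g) <= d.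
  have b1 : m.+1%:R^-1 + (1 - phi (tag l)) <= d by apply: small_base; exact: mem_head.
  rewrite lerBlDr -lerBlDl; apply: le_trans (fwave_in (tag l) (tagged l)).
  by rewrite lerD2l lerN2.
have h2 : 1 - fwave (pair_wr (nil2_class w) (wr_top u)) <= 4 ^+ size w * d.
  by apply: IHw => y yw; apply: small_base; rewrite inE yw orbT.
have h3 : d <= 4 ^+ size w * d by rewrite ler_peMl // exprn_ege1 // ler1n.
rewrite /= exprS -mulrA; lra.
Qed.

(** A support point [y] far from [1] and from the position [x] bounds [fwave] by
the average of two diagonal values of [wave1_le]. *)
Lemma fwave_far (u : W) y : y \in supp (wr_base u) -> 3 / 4 < `|fwave u| ->
  2^-1 < phi y \/ 2^-1 < phi ((wr_top u)^-1 * y)%g.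
Proof.
move=> ys big; have := leP (phi y) 2^-1; case=> [h1|]; last by left.
have := leP (phi ((wr_top u)^-1 * y)%g) 2^-1; case=> [h2|]; last by right.
have b1 := wave1_le phi_npd m h2.
have b2 : wave phi m [:: y] 1%g 1%g <= 3 / 4.
  by apply: wave1_le; rewrite // invg1 mul1g.
have := wave_bound phi_npd m (wr_top u) 1%g ys; rewrite -/(fwave u).
by move: b1 b2 big => *; exfalso; lra.
Qed.
End Wave.

Section Alpha.
Variables (theta : P -> R) (E : seq G).
Hypothesis theta_npd : npd theta.

Let local_factor (p : P) (g : G) : R := theta (retr (mem E) (nil2_shift g^-1%g p)).

(** The only [g] for which the part of [g^-1 p] over [E] can be nontrivial. *)
Definition translates (p : P) : seq G :=
  undup [seq (y * e^-1)%g | y <- supp p, e <- E].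

(** Formally the product over all [g] in [G] of [local_factor p g], which makes
it shift invariant. *)
Definition alpha (p : P) : R := \prod_(g <- translates p) local_factor p g.

Lemma alpha_ext (p : P) (gs : seq G) : uniq gs -> {subset translates p <= gs} ->
  alpha p = \prod_(g <- gs) local_factor p g.
Proof.
move=> ugs sub; rewrite (bigID (mem (translates p)) predT) /= [X in _ * X]big1.
  rewrite mulr1 -big_filter; apply: perm_big; apply: uniq_perm.
  - exact: undup_uniq.
  - exact: filter_uniq.
  - by move=> g; rewrite mem_filter; case: (boolP (g \in translates p)) => //= /sub ->.
move=> g gp; rewrite /local_factor retr_supp0 ?(proj1 theta_npd) // => y.
rewrite (perm_mem (supp_shift _ _)) => /mapP[z zp ->]; apply: contra gp => eE.
rewrite mem_undup; apply/allpairsP; exists (z, (g^-1 * z)%g); split => //=.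
by rewrite invgM invgK mulVKg.
Qed.

Lemma alpha1 : alpha 1%g = 1.
Proof. by rewrite /alpha /translates supp1 /= big_nil. Qed.

Lemma alpha_shift x p : alpha (nil2_shift x p) = alpha p.
Proof.
rewrite (@alpha_ext _ [seq (x * g)%g | g <- translates p]).
- rewrite big_map; apply: eq_bigr => g _; rewrite /local_factor -nil2_shiftA.
  by rewrite invgM mulgVK.
- by rewrite map_inj_uniq ?undup_uniq //; exact: mulgI.
- move=> g; rewrite mem_undup => /allpairsP[[y e] /= [yp eE ->]].
  move: yp; rewrite (perm_mem (supp_shift _ _)) => /mapP[z zp ->].
  by rewrite -mulgA map_f // mem_undup; apply: allpairs_f.
Qed.

Lemma alpha_npd : npd (fun u : W => alpha (wr_base u)).
Proof.
split; first by rewrite wr_base1 alpha1.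
apply: psd_local => s.
pose gs := undup (flatten [seq translates ((wr_base v)^-1 * wr_base u)%g | u <- s, v <- s]).
pose K (p : P) := \prod_(g <- gs) local_factor p g.
have K_npd : npd K.
  apply: npd_prod => g; apply: npd_comp theta_npd => p q.
  have sV (r : P) : nil2_shift g^-1%g r^-1%g = (nil2_shift g^-1%g r)^-1%g.
    apply: (mulgI (nil2_shift g^-1%g r)); rewrite -nil2_shiftM !mulgV.
    by apply: (mulgI (nil2_shift g^-1%g (1%g : P))); rewrite -nil2_shiftM !mulg1.
  by rewrite nil2_shiftM retrM sV retrV.
exists (fun u v => K ((wr_base v)^-1 * wr_base u)%g).
  exact: (psd_pull wr_base (proj2 K_npd)).
move=> u v us vs; rewrite wr_baseVM alpha_shift; apply: alpha_ext; first exact: undup_uniq.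
move=> g gt; rewrite mem_undup; apply/flattenP.
by exists (translates ((wr_base v)^-1 * wr_base u)%g) => //; apply: allpairs_f.
Qed.

Lemma alpha_near p (d : R) :
  (forall g, g \in translates p -> 1 - local_factor p g <= d) ->
  1 - alpha p <= (size (translates p))%:R * d.
Proof.
move=> small; apply: le_trans (prod_dist _ _) _.
  by move=> g; exact: (npd_norm _ theta_npd).
apply: le_trans (_ : \sum_(g <- translates p) d <= _).
  by rewrite [leLHS]big_seq [leRHS]big_seq; apply: ler_sum.
by rewrite big_const_seq count_predT iter_addr_0 mulr_natl.
Qed.

Lemma alpha_le p : retr (mem E) p = p -> `|alpha p| <= `|theta p|.
Proof.
move=> Ep; rewrite (@alpha_ext p (undup (1%g :: translates p))) ?undup_uniq //; last first.
  by move=> g gp; rewrite mem_undup inE gp orbT.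
rewrite (bigD1_seq 1%g) ?undup_uniq ?mem_undup ?mem_head //=.
rewrite /local_factor invg1 nil2_shift1 Ep normrM ler_piMr //.
elim/big_ind: _ => [|x y x1 y1|g _]; rewrite ?normr1 //.
  by rewrite normrM mulr_ile1.
exact: (npd_norm _ theta_npd).
Qed.
End Alpha.

Section Theta.
Variables (fH : H -> R) (fN : nilquot G H -> R).
Variable E : seq G.
Hypotheses (fH_npd : npd fH) (fN_npd : npd fN).

Definition theta (p : P) : R := (\prod_(y <- E) fH (component y p)) * fN (nilproj p).

Lemma theta_npd : npd theta.
Proof.
apply: npdM.
  by apply: npd_prod => y; apply: npd_comp fH_npd => u v; rewrite componentM componentV.
by apply: npd_comp fN_npd => u v; rewrite nilprojM nilprojV.
Qed.

Lemma theta_near p (d : R) : (forall y, y \in E -> 1 - fH (component y p) <= d) ->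
  1 - fN (nilproj p) <= d -> 1 - theta p <= (size E).+1%:R * d.
Proof.
move=> h1 h2.
have n1 : npd (fun p : P => \prod_(y <- E) fH (component y p)).
  by apply: npd_prod => y; apply: npd_comp fH_npd => u v; rewrite componentM componentV.
have b1 : 1 - \prod_(y <- E) fH (component y p) <= (size E)%:R * d.
  apply: le_trans (prod_dist _ _) _; first by move=> y; exact: npd_norm.
  apply: le_trans (_ : \sum_(y <- E) d <= _).
    by rewrite [leLHS]big_seq [leRHS]big_seq; apply: ler_sum.
  by rewrite big_const_seq count_predT iter_addr_0 mulr_natl.
have := npd_le1 p n1; have := npd_norm (nilproj p) fN_npd; rewrite ler_norml.
move: b1 h2; rewrite /theta -natr1 mulrDl mul1r.
set a := \prod_(y <- E) _; set b := fN _; set c := _ * d.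
move: a b c => a b c *; nra.
Qed.

Fixpoint lists (T : eqType) (A : seq T) n : seq (seq T) :=
  if n is n'.+1 then [seq a :: t | a <- A, t <- lists A n'] else [:: [::]].

Lemma mem_lists (T : eqType) (A : seq T) (t : seq T) :
  {subset t <= A} -> t \in lists A (size t).
Proof.
elim: t => [//|a t IHt] tA /=; apply: allpairs_f; first by apply: tA; rewrite mem_head.
by apply: IHt => b bt; apply: tA; rewrite inE bt orbT.
Qed.

Lemma finite_inj (X : Type) (T : eqType) (A : set X) (h : X -> T) (s : seq T) :
  {in A &, injective h} -> (forall x, A x -> h x \in s) -> finite_set A.
Proof.
move=> h_inj hs; rewrite -(eq_finite_set (inj_card_eq h_inj)).
apply: (@sub_finite_set _ _ [set` s]); last exact: finite_seq.
by move=> _ [x Ax <-]; exact: hs.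
Qed.

(** Over [E], an element is determined by its class modulo [derp] and its
coordinates in [E], all of which stay in finite sets. *)
Lemma theta_fin (e : R) : 0 < e -> vanishing fH -> vanishing fN ->
  finite_set [set p : P | retr (mem E) p = p /\ e <= `|theta p|].
Proof.
move=> e0 /(_ e e0)/finite_seqP[sH EH] /(_ e e0)/finite_seqP[sN EN].
have memH a : e <= `|fH a| -> a \in sH.
  by move=> ea; have : [set g | e <= `|fH g|] a by []; rewrite EH.
have memN a : e <= `|fN a| -> a \in sN.
  by move=> ea; have : [set g | e <= `|fN g|] a by []; rewrite EN.
apply: (@finite_inj _ _ _ (fun p => (nilproj p, [seq component y p | y <- E]))
  [seq (n, t) | n <- sN, t <- lists sH (size E)]).
- move=> p q; rewrite !inE /= => -[Ep _] [Eq _] [npq cpq].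
  apply: nilproj_eq => // y; case: (boolP (y \in E)) => yE.
    by move: cpq => /eq_in_map; exact.
  have out r : retr (mem E) r = r -> component y r = 1%g.
    move=> <-; elim/nil2_ind: r => [|i a r IHr]; first by rewrite retr1 component1.
    rewrite retrM componentM IHr mulg1 retr_in /=; case: ifP => [iE|_].
      by rewrite component_in; case: eqP => // iy; rewrite -iy iE in yE.
    exact: component1.
  by rewrite !out.
- move=> p [_ ep]; have [pa pb] : (forall y, y \in E -> e <= `|fH (component y p)|) /\
      e <= `|fN (nilproj p)|.
    have pr1 s : `|\prod_(y <- s) fH (component y p)| <= 1.
      elim/big_ind: _ => [|x y x1 y1|y _]; rewrite ?normr1 //.
        by rewrite normrM mulr_ile1.
      exact: npd_norm.
    split; last first.
      apply: le_trans ep _; rewrite /theta normrM ler_piMl //; exact: pr1.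
    move=> y yE; apply: le_trans ep _; rewrite /theta normrM.
    apply: le_trans (_ : `|\prod_(z <- E) fH (component z p)| <= _).
      by rewrite ler_piMr // npd_norm.
    rewrite (perm_big _ (perm_to_rem yE)) big_cons normrM ler_piMr //; exact: pr1.
  apply: allpairs_f; first exact: memN.
  rewrite -(size_map (fun y => component y p)); apply: mem_lists.
  by move=> _ /mapP[y yE ->]; apply: memH; exact: pa.
Qed.
End Theta.

Lemma wreath_countable : countable [set: H] -> countable [set: G] ->
  countable [set: W].
Proof.
move=> /countable_injP[cH injH] /countable_injP[cG injG].
apply/countable_injP.
pose code (l : {k : G & H}) := (cG (tag l), cH (tagged l)).
have code_inj : injective code.
  move=> [k a] [k' a'] [/injG h1 /injH h2].
  by rewrite h1 ?inE // h2 ?inE.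
exists (fun u => pickle ([seq code l | l <- nil2_word (wr_base u)], cG (wr_top u))).
move=> u v _ _ /(pcan_inj pickleK)[/(inj_map code_inj) h1 /injG h2].
apply: wreath_eq; last by apply: h2; rewrite inE.
by rewrite -(nil2_wordK (wr_base u)) h1 nil2_wordK.
Qed.

End Assembly.

(** * The Haagerup property of the wreath product *)

Section Main.
Variables (R : realType) (H G : groupType).
Local Notation Hs := (fun _ : G => H).
Local Notation P := (nil2_product Hs).
Local Notation W := (nil2_wreath H G).

(** Order of the choices: [m] from [Q] and [e]; then [phi], close to [1] on the
indices and positions that occur in [Q]; then [E], the products of two elements
of the finite set [X] where [phi] exceeds [1 / 2]; then [fH] and [fN], close to
[1] on the finitely many translates that enter [alpha] on [Q]. *)
Lemma wreath_near_far (Q : seq W) (e : R) :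
  real_haagerup R H -> real_haagerup R G -> 0 < e ->
  exists f : W -> R, [/\ npd f, finite_set [set u | 3 / 4 < `|f u|] &
    forall u, u \in Q -> 1 - e <= f u].
Proof.
move=> haagH haagG e0.
pose N := (\max_(u <- Q) size (nil2_word (wr_base u)))%N.
have sizeN u : u \in Q -> (size (nil2_word (wr_base u)) <= N)%N.
  by move=> uQ; exact: leq_bigmax_seq.
have e30 : 0 < e / 3 by rewrite divr_gt0.
(* [npd_mul] costs a factor [4] per letter: [d] is the allowance of one letter. *)
pose d : R := e / 3 / 4 ^+ N.
have d0 : 0 < d by rewrite divr_gt0 ?exprn_gt0.
have de : d <= e / 3.
  by rewrite ler_pdivrMr ?exprn_gt0 // ler_peMr ?(ltW e30) // exprn_ege1 // ler1n.
pose m := Num.truncn (2 / d).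
have m_small : m.+1%:R^-1 <= d / 2.
  rewrite -[d / 2]invrK lef_pV2 ?posrE ?ltr0n ?invr_gt0 ?divr_gt0 //.
  by rewrite invf_div ltW // truncnS_gt.
pose eta := d / (2 * m%:R ^+ 2 + 2).
have c2 : 2 <= 2 * m%:R ^+ 2 + 2 :> R by rewrite lerDr mulr_ge0 // exprn_ge0.
have cpos : 0 < 2 * m%:R ^+ 2 + 2 :> R by exact: lt_le_trans c2.
have eta0 : 0 < eta by rewrite divr_gt0.
have eta_d2 : eta <= d / 2 by rewrite ler_pM2l // lef_pV2 ?posrE.
have eta_top : 2 * m%:R ^+ 2 * eta <= d.
  have dE : d = (2 * m%:R ^+ 2 + 2) * eta by rewrite /eta mulrC divfK ?gt_eqF.
  rewrite [leRHS]dE.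
  by rewrite ler_pM2r // lerDl.
pose S := [seq wr_top u | u <- Q] ++ flatten [seq map tag (nil2_word (wr_base u)) | u <- Q].
have [phi [phi_npd phi_c0 phi_near]] := haagG S eta eta0.
have phi_top u : u \in Q -> 1 - phi (wr_top u) <= eta.
  by move=> uQ; rewrite lerBlDr -lerBlDl phi_near // mem_cat map_f.
have phi_tag u y : u \in Q -> y \in map tag (nil2_word (wr_base u)) -> 1 - phi y <= eta.
  move=> uQ yu; rewrite lerBlDr -lerBlDl phi_near // mem_cat; apply/orP; right.
  by apply/flattenP; exists (map tag (nil2_word (wr_base u))) => //; exact: map_f.
have half0 : 0 < 2^-1 :> R by rewrite invr_gt0.
have /finite_seqP[X EX] := phi_c0 _ half0.
have memX g : 2^-1 < phi g -> g \in X.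
  move=> h; have : [set g | 2^-1 <= `|phi g|] g.
    by apply: le_trans (ltW h) (ler_norm _).
  by rewrite EX.
have X1 : 1%g \in X by apply: memX; rewrite (proj1 phi_npd) invf_lt1 // ltr1n.
pose E := [seq (x * y)%g | x <- X, y <- X].
pose PQ := [seq retr (mem E) (nil2_shift g^-1%g (wr_base u)) | u <- Q, g <- translates E (wr_base u)].
pose M := (\max_(u <- Q) size (translates E (wr_base u)))%N.
have sizeM u : u \in Q -> (size (translates E (wr_base u)) <= M)%N.
  by move=> uQ; exact: leq_bigmax_seq.
pose k : R := M.+1%:R * (size E).+1%:R.
have k0 : 0 < k by rewrite mulr_gt0 // ltr0n.
pose zeta := e / 3 / k.
have zeta0 : 0 < zeta by rewrite divr_gt0.
have [fH [fH_npd fH_c0 fH_near]] := haagH [seq component y p | p <- PQ, y <- E] zeta zeta0.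
have [fN [fN_npd fN_c0 fN_near]] :=
  class2_haagerup (@nilquot_class2 G H) (map (@nilproj G H) PQ) zeta0.
pose th := theta fH fN E.
have th_npd : npd th := theta_npd E fH_npd fN_npd.
have a_npd := alpha_npd E th_npd.
have w_npd := fwave_npd H m phi_npd.
have t_npd : npd (fun u : W => phi (wr_top u)) by exact: npd_comp phi_npd.
exists (fun u => phi (wr_top u) * (fwave phi m u * alpha th E (wr_base u))); split.
- exact: npdM t_npd (npdM w_npd a_npd).
- have h34 : 0 < 3 / 4 :> R by rewrite divr_gt0.
  have /finite_seqP[Y EY] := theta_fin E fH_npd fN_npd h34 fH_c0 fN_c0.
  apply: (@finite_inj _ _ _ (fun u => (wr_base u, wr_top u)) [seq (p, x) | p <- Y, x <- X]).
    by move=> u v _ _ [h1 h2]; exact: wreath_eq.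
  move=> u /=; rewrite (normrM (phi (wr_top u))) (normrM (fwave phi m u)) => big.
  have n1 : `|phi (wr_top u)| <= 1 := npd_norm u t_npd.
  have n2 : `|fwave phi m u| <= 1 := npd_norm u w_npd.
  have n3 : `|alpha th E (wr_base u)| <= 1 := npd_norm u a_npd.
  have b1 : 3 / 4 < `|phi (wr_top u)|.
    by apply: lt_le_trans big _; rewrite ler_piMr // mulr_ile1.
  have b23 : 3 / 4 < `|fwave phi m u| * `|alpha th E (wr_base u)|.
    by apply: lt_le_trans big _; rewrite ler_piMl // mulr_ge0.
  have b2 : 3 / 4 < `|fwave phi m u| by apply: lt_le_trans b23 _; rewrite ler_piMr.
  have b3 : 3 / 4 < `|alpha th E (wr_base u)| by apply: lt_le_trans b23 _; rewrite ler_piMl.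
  have topX : wr_top u \in X.
    have : [set g | 2^-1 <= `|phi g|] (wr_top u) by move: b1 => /=; lra.
    by rewrite EX.
  have suppE : {subset supp (wr_base u) <= E}.
    move=> y yu; case: (fwave_far phi_npd yu b2) => /memX yX.
      by rewrite -(mul1g y); exact: allpairs_f.
    by rewrite -(mulVKg (wr_top u) y); exact: allpairs_f.
  (* The factor of [alpha] at [g = 1] is [theta] itself. *)
  have retrE : retr (mem E) (wr_base u) = wr_base u by exact: retr_supp.
  apply: allpairs_f => //.
  have : [set p : P | retr (mem E) p = p /\ 3 / 4 <= `|th p|] (wr_base u).
    by split => //; apply/ltW/(lt_le_trans b3)/alpha_le.
  by rewrite EY.
- move=> u uQ.
  have l1 : 1 - phi (wr_top u) <= e / 3.
    by apply: le_trans (phi_top u uQ) _; lra.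
  have l2 : 1 - fwave phi m u <= e / 3.
    apply: le_trans (fwave_near phi_npd (ltW d0) _ _) _.
    - move=> y yu; rewrite [leRHS]splitr.
      by apply: lerD => //; exact: le_trans (phi_tag u y uQ yu) eta_d2.
    - by apply: le_trans eta_top; rewrite ler_wpM2l ?phi_top // mulr_ge0 // exprn_ge0.
    - rewrite /d mulrA ler_pdivrMr ?exprn_gt0 // mulrC ler_pM2l //.
      by rewrite ler_weXn2l ?ler1n // sizeN.
  have l3 : 1 - alpha th E (wr_base u) <= e / 3.
    apply: le_trans (alpha_near (d := (size E).+1%:R * zeta) th_npd _) _.
      move=> g gu.
      have inPQ : retr (mem E) (nil2_shift g^-1%g (wr_base u)) \in PQ.
        by apply/allpairsPdep; exists u, g.
      apply: theta_near => // [y yE|].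
        by rewrite lerBlDr -lerBlDl fH_near //; exact: allpairs_f.
      by rewrite lerBlDr -lerBlDl fN_near //; exact: map_f.
    have -> : e / 3 = M.+1%:R * ((size E).+1%:R * zeta).
      by rewrite mulrA -/k /zeta [RHS]mulrC divfK ?gt_eqF.
    apply: ler_wpM2r; first by rewrite mulr_ge0 ?ltW.
    by rewrite ler_nat leqW // sizeM.
  move: l1 l2 l3 (npd_norm u t_npd) (npd_norm u w_npd) (npd_norm u a_npd).
  set x := phi _; set y := fwave _ _ _; set z := alpha _ _ _ => l1 l2 l3 n1 n2 n3.
  have := prod_dist [:: 0%N; 1%N; 2%N] (a := fun i => nth 1 [:: x; y; z] i).
  rewrite !big_cons !big_nil /= mulr1 addr0 => h.
  have := h _; rewrite lerBlDr => h'.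
  have : 1 <= (1 - x + (1 - y + (1 - z))) + x * (y * z).
    by apply: h'; case=> [|[|[|i]]] //=; rewrite nth_nil normr1.
  by move: l1 l2 l3; clear; lra.
Qed.

End Main.

Theorem mainTheorem3 (R : realType) (H G : groupType)
  (countableH : countable [set: H]) (countableG : countable [set: G])
  (haagerupH : haagerup R H) (haagerupG : haagerup R G) :
  haagerup R (nil2_wreath H G).
Proof.
have c34 : 0 <= (3 / 4 : R) < 1.
  by rewrite divr_ge0 //= ltr_pdivrMr // mul1r ltr_nat.
apply: haagerup_criterion (wreath_countable countableH countableG) c34 _ => Q e.
by apply: wreath_near_far; exact: haagerup_real.
Qed.
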